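(* If $\mathsf{ZFC}$ is consistent, then so is $\mathsf{ZF}+\mathsf{WUF(?)}+$''every ultrafilter is $\sigma$-complete''.
   Context: $\mathsf{WUF(?)}$: there is a non-principal ultrafilter over some set. An ultrafilter $U$ is $\sigma$-complete if for every family $\{X_n\mid n<\omega\}\subseteq U$ (indexed by $\omega$), $\bigcap_nX_n\in U$. *)

(* Defs.v *)
From Stdlib Require Import List.
Import ListNotations.

(** Variables are de Bruijn indices: [n] refers to the [n]-th enclosing
    quantifier, counted from the innermost one. The signature has no function
    symbols, so terms are variables and a substitution is a map [nat -> nat]. *)

Inductive form : Set :=
| Bot : form
| Mem : nat -> nat -> form
| Eq  : nat -> nat -> form
| Imp : form -> form -> form
| All : form -> form.

Definition Neg (φ : form) : form := Imp φ Bot.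
Definition Or (φ ψ : form) : form := Imp (Neg φ) ψ.
Definition And (φ ψ : form) : form := Neg (Imp φ (Neg ψ)).
Definition Iff (φ ψ : form) : form := And (Imp φ ψ) (Imp ψ φ).
Definition Ex (φ : form) : form := Neg (All (Neg φ)).

Declare Scope fol_scope.
Delimit Scope fol_scope with fol.
Bind Scope fol_scope with form.

Notation "x ∈ y" := (Mem x y) (at level 70, no associativity) : fol_scope.
Notation "x ≐ y" := (Eq x y) (at level 70, no associativity) : fol_scope.
Notation "⊥" := Bot : fol_scope.
Notation "¬ φ" := (Neg φ) (at level 75, right associativity) : fol_scope.
Notation "φ ∧ ψ" := (And φ ψ) (at level 80, right associativity) : fol_scope.
Notation "φ ∨ ψ" := (Or φ ψ) (at level 85, right associativity) : fol_scope.
Notation "φ ⟶ ψ" := (Imp φ ψ) (at level 90, right associativity) : fol_scope.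
Notation "φ ⟷ ψ" := (Iff φ ψ) (at level 91, no associativity) : fol_scope.
Notation "∀ φ" := (All φ) (at level 94, right associativity) : fol_scope.
Notation "∃ φ" := (Ex φ) (at level 94, right associativity) : fol_scope.

Local Open Scope fol_scope.

Definition scons (x : nat) (r : nat -> nat) (n : nat) : nat :=
  match n with 0 => x | S m => r m end.
Notation "x .: r" := (scons x r) (at level 55, right associativity).

Fixpoint subst (r : nat -> nat) (φ : form) : form :=
  match φ with
  | Bot => Bot
  | Mem x y => Mem (r x) (r y)
  | Eq x y => Eq (r x) (r y)
  | Imp φ ψ => Imp (subst r φ) (subst r ψ)
  | All φ => All (subst (0 .: fun n => S (r n)) φ)
  end.

(** The least [n] such that all free variables of [φ] are below [n]. *)
Fixpoint fv_bound (φ : form) : nat :=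
  match φ with
  | Bot => 0
  | Mem x y | Eq x y => Nat.max (S x) (S y)
  | Imp φ ψ => Nat.max (fv_bound φ) (fv_bound ψ)
  | All φ => Nat.pred (fv_bound φ)
  end.

Definition closure (φ : form) : form := Nat.iter (fv_bound φ) All φ.

Reserved Notation "Γ ⊢ φ" (at level 99, no associativity).

Inductive prv : list form -> form -> Prop :=
| Hyp Γ φ : In φ Γ -> Γ ⊢ φ
| ImpI Γ φ ψ : (φ :: Γ ⊢ ψ) -> Γ ⊢ (φ ⟶ ψ)
| ImpE Γ φ ψ : (Γ ⊢ (φ ⟶ ψ)) -> (Γ ⊢ φ) -> Γ ⊢ ψ
| Raa Γ φ : ((¬ φ) :: Γ ⊢ ⊥) -> Γ ⊢ φ
| AllI Γ φ : (map (subst S) Γ ⊢ φ) -> Γ ⊢ (∀ φ)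
| AllE Γ φ x : (Γ ⊢ (∀ φ)) -> Γ ⊢ subst (x .: fun n => n) φ
| EqI Γ x : Γ ⊢ (x ≐ x)
| EqE Γ φ x y : (Γ ⊢ (x ≐ y)) -> (Γ ⊢ subst (x .: fun n => n) φ) ->
    Γ ⊢ subst (y .: fun n => n) φ
where "Γ ⊢ φ" := (prv Γ φ).

Definition theory := form -> Prop.

Definition proves (T : theory) (φ : form) : Prop :=
  exists Γ, (forall ψ, In ψ Γ -> T ψ) /\ (Γ ⊢ φ).

Definition consistent (T : theory) : Prop := ~ proves T ⊥.

Definition extend (T : theory) (φ : form) : theory := fun ψ => T ψ \/ ψ = φ.

(** The set-theoretic notions below take the indices of their free variables; an argument [x]
    is written [k + x] below [k] further quantifiers. *)

Definition is_empty x := ∀ ¬ 0 ∈ 1+x.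
Definition is_subset x y := ∀ (0 ∈ 1+x ⟶ 0 ∈ 1+y).

(** [z = {x, y}] *)
Definition is_pair z x y := ∀ (0 ∈ 1+z ⟷ 0 ≐ 1+x ∨ 0 ≐ 1+y).
(** [z = ⋃ x] *)
Definition is_union z x := ∀ (0 ∈ 1+z ⟷ ∃ (0 ∈ 2+x ∧ 1 ∈ 0)).
(** [z = P(x)] *)
Definition is_power z x := ∀ (0 ∈ 1+z ⟷ is_subset 0 (1+x)).
(** [z = x ∩ y] *)
Definition is_inter z x y := ∀ (0 ∈ 1+z ⟷ 0 ∈ 1+x ∧ 0 ∈ 1+y).
(** [z = x \ y] *)
Definition is_diff z x y := ∀ (0 ∈ 1+z ⟷ 0 ∈ 1+x ∧ ¬ 0 ∈ 1+y).
(** [z = x ∪ {x}] *)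
Definition is_succ z x := ∀ (0 ∈ 1+z ⟷ 0 ∈ 1+x ∨ 0 ≐ 1+x).

(** [p = (x, y) = {{x}, {x, y}}] *)
Definition is_opair p x y :=
  ∃ ∃ (is_pair 1 (2+x) (2+x) ∧ is_pair 0 (2+x) (2+y) ∧ is_pair (2+p) 1 0).
(** [(x, y) ∈ f] *)
Definition maps_to f x y := ∃ (is_opair 0 (1+x) (1+y) ∧ 0 ∈ 1+f).
(** [f : d -> c] *)
Definition is_function f d c :=
  (∀ (0 ∈ 1+f ⟶ ∃ ∃ (1 ∈ 3+d ∧ 0 ∈ 3+c ∧ is_opair 2 1 0)))
  ∧ (∀ (0 ∈ 1+d ⟶ ∃ maps_to (2+f) 1 0))
  ∧ (∀ ∀ ∀ (maps_to (3+f) 2 1 ∧ maps_to (3+f) 2 0 ⟶ 1 ≐ 0)).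

Definition is_inductive x :=
  (∃ (is_empty 0 ∧ 0 ∈ 1+x))
  ∧ (∀ (0 ∈ 1+x ⟶ ∃ (is_succ 0 1 ∧ 0 ∈ 2+x))).
Definition is_omega w :=
  is_inductive w ∧ (∀ (is_inductive 0 ⟶ is_subset (1+w) 0)).

Definition ax_ext := ∀ ∀ ((∀ (0 ∈ 2 ⟷ 0 ∈ 1)) ⟶ 1 ≐ 0).
Definition ax_found :=
  ∀ ((∃ 0 ∈ 1) ⟶ ∃ (0 ∈ 1 ∧ ¬ ∃ (0 ∈ 2 ∧ 0 ∈ 1))).
Definition ax_pair := ∀ ∀ ∃ is_pair 0 2 1.
Definition ax_union := ∀ ∃ is_union 0 1.
Definition ax_power := ∀ ∃ is_power 0 1.
Definition ax_inf := ∃ is_inductive 0.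

(** [∀ a, ∃ b, ∀ x, x ∈ b ⟷ x ∈ a ∧ φ(x)], universally closed. In [φ], [0]
    is [x] and the remaining indices are the parameters. *)
Definition ax_sep (φ : form) :=
  closure (∀ ∃ ∀ (0 ∈ 1 ⟷ 0 ∈ 2 ∧ subst (0 .: fun n => 3+n) φ)).

(** If [φ(x, y)] is functional then
    [∀ a, ∃ b, ∀ y, y ∈ b ⟷ ∃ x, x ∈ a ∧ φ(x, y)], universally closed.
    In [φ], [0] is [x], [1] is [y] and the remaining indices are the
    parameters. *)
Definition ax_repl (φ : form) :=
  closure
    ((∀ ∀ ∀ (subst (2 .: 1 .: fun n => 3+n) φ
             ∧ subst (2 .: 0 .: fun n => 3+n) φ ⟶ 1 ≐ 0))
     ⟶ ∀ ∃ ∀ (0 ∈ 1 ⟷ ∃ (0 ∈ 3 ∧ subst (0 .: 1 .: fun n => 4+n) φ))).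

Inductive ZF : theory :=
| ZF_ext : ZF ax_ext
| ZF_found : ZF ax_found
| ZF_pair : ZF ax_pair
| ZF_union : ZF ax_union
| ZF_power : ZF ax_power
| ZF_inf : ZF ax_inf
| ZF_sep φ : ZF (ax_sep φ)
| ZF_repl φ : ZF (ax_repl φ).

(** Every set [a] of nonempty sets has a choice function [f : a -> ⋃ a]. *)
Definition ax_choice :=
  ∀ ((∀ (0 ∈ 1 ⟶ ¬ is_empty 0))
     ⟶ ∃ ∃ (is_union 1 2 ∧ is_function 0 2 1
            ∧ ∀ ∀ (1 ∈ 4 ∧ maps_to 2 1 0 ⟶ 0 ∈ 1))).

Definition ZFC : theory := extend ZF ax_choice.

(** [u] is a (proper) filter over the set [x] *)
Definition is_filter u x :=
  (∀ (0 ∈ 1+u ⟶ is_subset 0 (1+x)))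
  ∧ x ∈ u
  ∧ (∀ (is_empty 0 ⟶ ¬ 0 ∈ 1+u))
  ∧ (∀ ∀ (1 ∈ 2+u ∧ is_subset 1 0 ∧ is_subset 0 (2+x) ⟶ 0 ∈ 2+u))
  ∧ (∀ ∀ ∀ (2 ∈ 3+u ∧ 1 ∈ 3+u ∧ is_inter 0 2 1 ⟶ 0 ∈ 3+u)).

Definition is_ultrafilter u x :=
  is_filter u x
  ∧ ∀ ∀ (is_subset 1 (2+x) ∧ is_diff 0 (2+x) 1 ⟶ 1 ∈ 2+u ∨ 0 ∈ 2+u).

(** [u = {a ⊆ x | p ∈ a}] for some [p ∈ x] *)
Definition is_principal u x :=
  ∃ (0 ∈ 1+x ∧ ∀ (0 ∈ 2+u ⟷ is_subset 0 (2+x) ∧ 1 ∈ 0)).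

(** For every [f : ω -> u], the set [⋂_(n ∈ ω) f(n)] is in [u]. Below the
    four innermost quantifiers, [3] is [⋂_n f(n)], [2] a point of it, [1] is
    [n] and [0] is [f(n)]. *)
Definition is_sigma_complete u :=
  ∀ ∀ (is_omega 1 ∧ is_function 0 1 (2+u)
       ⟶ ∃ (0 ∈ 3+u
            ∧ ∀ (0 ∈ 1 ⟷ ∀ ∀ (1 ∈ 5 ∧ maps_to 4 1 0 ⟶ 2 ∈ 0)))).

Definition WUF : form := ∃ ∃ (is_ultrafilter 0 1 ∧ ¬ is_principal 0 1).

Definition every_ultrafilter_sigma_complete : form :=
  ∀ ∀ (is_ultrafilter 0 1 ⟶ is_sigma_complete 0).

(* Main.v *)
From Stdlib Require Import List Arith Lia Bool Classical ClassicalEpsilon.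
From Stdlib Require Import FunctionalExtensionality ProofIrrelevance Morphisms Setoid.
Require Import Defs.

(** Universes make the hypothesis superfluous: with classical choice, [Type] plays the part of a
    universe of sets, and the symmetric extension below is a model of the theory built directly
    over it, in the sense that every axiom is forced and forcing is sound for [prv].

    Add Cohen reals [a_i], [i < ω], with finite partial functions [ω × ω -> 2]. The automorphisms
    permute finitely many of the indices [i] and flip an arbitrary set of bits; a name is symmetric
    when it is fixed by all automorphisms that act trivially on [a_0, ..., a_(n-1)] for some [n].

    If [u] were an ultrafilter, with support [m], that is not σ-complete, witnessed by
    [f : ω -> u], then [z ↦ min {n | z ∉ f(n)}] would push [u] to an ultrafilter on [ω] all of whose
    members are infinite. Flipping [a_m] above the bits decided by a condition fixes the
    condition and [u], but exchanges [a_m] with its complement up to a finite set, although the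
    pushed ultrafilter contains exactly one of the two.

    Let [A_i] be the set of all [a_i Δ X] with [X] in the ground model. Given a condition, exchanging
    [A_i] and [A_j] can be combined with flips such that the condition and its image are
    compatible. So a subset of [A = {A_i | i < ω}] with support [m] contains all or none of the
    [A_i] with [i >= m], and the cofinite subsets of [A] form a non-principal ultrafilter. *)

(** * Symmetric names *)

Record symmetric_system : Type := {
  cond : Type;
  le : cond -> cond -> Prop;
  le_refl : forall p, le p p;
  le_trans : forall p q r, le p q -> le q r -> le p r;
  aut : Type;
  app : aut -> cond -> cond;
  inv : aut -> aut;
  app_inv : forall g p, app g (app (inv g) p) = p;
  inv_app : forall g p, app (inv g) (app g p) = p;
  app_le : forall g p q, le p q -> le (app g p) (app g q);
  (* The subgroups [fixes n] generate the normal filter; [fixes_conj] is its normality. *)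
  fixes : nat -> aut -> Prop;
  fixes_le : forall m n g, m <= n -> fixes n g -> fixes m g;
  fixes_inv : forall n g, fixes n g -> fixes n (inv g);
  fixes_conj : forall g n, exists m, forall h, fixes m h ->
    exists h', fixes n h' /\ forall p, app h (app g p) = app g (app h' p)
}.

Section Forcing.

Context {W : symmetric_system}.

Notation P := (cond W).
Notation "p ≤ q" := (le W p q) (at level 70, no associativity).

Hint Resolve le_refl : core.
Local Ltac ord := solve [eauto using le_trans].

(** Disjunctions and existential statements are forced in this sense: a witness need only appear
    below every stronger condition. *)
Definition densely (Q : P -> Prop) (p : P) : Prop :=
  forall q, q ≤ p -> exists r, r ≤ q /\ Q r.

Lemma densely_intro (Q : P -> Prop) p :
  (forall q, q ≤ p -> Q q) -> densely Q p.
Proof. intros H q Hq. exists q. auto. Qed.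

Lemma densely_le (Q : P -> Prop) p q : q ≤ p -> densely Q p -> densely Q q.
Proof. intros Hq H r Hr. apply H. ord. Qed.

Lemma densely_bind (Q R : P -> Prop) p :
  densely Q p -> (forall q, q ≤ p -> Q q -> densely R q) -> densely R p.
Proof.
  intros H K q Hq. destruct (H q Hq) as (r & Hr & HQ).
  destruct (K r (le_trans _ _ _ _ Hr Hq) HQ r (le_refl _ _)) as (s & Hs & HR).
  exists s. split; [ord|eauto].
Qed.

Lemma densely_mono (Q R : P -> Prop) p :
  densely Q p -> (forall q, q ≤ p -> Q q -> R q) -> densely R p.
Proof.
  intros H K q Hq. destruct (H q Hq) as (r & Hr & HQ).
  exists r. split; [ord|apply K; ord].
Qed.

Lemma densely_inv g (Q : P -> Prop) p :
  densely Q p -> densely (fun q => Q (app W (inv W g) q)) (app W g p).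
Proof.
  intros H q Hq. apply (app_le W (inv W g)) in Hq. rewrite inv_app in Hq.
  destruct (H _ Hq) as (r & Hr & HQ). exists (app W g r).
  rewrite inv_app. split; auto. apply (app_le W g) in Hr.
  now rewrite app_inv in Hr.
Qed.

Lemma le_app_inv g p q : q ≤ app W g p -> app W (inv W g) q ≤ p.
Proof. intros H. apply (app_le W (inv W g)) in H. now rewrite inv_app in H. Qed.

Lemma app_inv_le g p q : q ≤ app W (inv W g) p -> app W g q ≤ p.
Proof. intros H. apply (app_le W g) in H. now rewrite app_inv in H. Qed.

(** A name is a well-founded tree whose index types stand in for ground-model sets; [c a] is the
    condition that puts [f a] into the set. *)
Inductive name : Type := mk (A : Type) (f : A -> name) (c : A -> P).

(** [name_eq x y p] is [p ⊩ x ≐ y], with the membership clause of [name_mem] unfolded. *)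
Fixpoint name_eq (x y : name) (p : P) : Prop :=
  match x, y with
  | mk A f c, mk B g d =>
    (forall a q, q ≤ p -> q ≤ c a -> exists r, r ≤ q /\ exists b, r ≤ d b /\ name_eq (f a) (g b) r)
    /\ (forall b q, q ≤ p -> q ≤ d b -> exists r, r ≤ q /\ exists a, r ≤ c a /\ name_eq (f a) (g b) r)
  end.

Definition name_mem (z y : name) (p : P) : Prop :=
  match y with
  | mk B g d => densely (fun r => exists b, r ≤ d b /\ name_eq z (g b) r) p
  end.

Fixpoint name_act (g : aut W) (x : name) : name :=
  match x with
  | mk A f c => mk A (fun a => name_act g (f a)) (fun a => app W g (c a))
  end.

Lemma name_eq_le x y p q : q ≤ p -> name_eq x y p -> name_eq x y q.
Proof.
  destruct x as [A f c], y as [B g d]; simpl. intros Hq [H1 H2].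
  split; intros; [apply H1|apply H2]; auto; ord.
Qed.

Lemma name_eq_refl x p : name_eq x x p.
Proof.
  revert p. induction x as [A f IH c]. intros p. simpl.
  split; intros a q Hq Ha; exists q; split; auto; exists a; auto.
Qed.

Lemma name_eq_sym x y p : name_eq x y p -> name_eq y x p.
Proof.
  revert y p. induction x as [A f IH c]. intros [B g d] p. simpl.
  intros [H1 H2]. split; intros a q Hq Ha.
  - destruct (H2 a q Hq Ha) as (r & Hr & b & Hb & E). eauto 6.
  - destruct (H1 a q Hq Ha) as (r & Hr & b & Hb & E). eauto 6.
Qed.

Lemma name_eq_trans x y z p : name_eq x y p -> name_eq y z p -> name_eq x z p.
Proof.
  revert y z p. induction x as [A f IH c]. intros [B g d] [C h e] p. simpl.
  intros [H1 H2] [K1 K2]. split.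
  - intros a q Hq Ha.
    destruct (H1 a q Hq Ha) as (r & Hr & b & Hb & E).
    destruct (K1 b r (le_trans _ _ _ _ Hr Hq) Hb) as (s & Hs & k & Hk & E').
    exists s. split; [ord|]. exists k. split; auto.
    eapply IH; [eapply name_eq_le; [|exact E]; exact Hs|auto].
  - intros k q Hq Hk.
    destruct (K2 k q Hq Hk) as (r & Hr & b & Hb & E).
    destruct (H2 b r (le_trans _ _ _ _ Hr Hq) Hb) as (s & Hs & a & Ha & E').
    exists s. split; [ord|]. exists a. split; auto.
    eapply IH; [exact E'|]. eapply name_eq_le; [|exact E]; exact Hs.
Qed.

(** Both clauses of [name_eq] already ask for a witness below an arbitrary stronger condition, so
    one unfolding suffices. *)
Lemma name_eq_dense x y p : densely (name_eq x y) p -> name_eq x y p.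
Proof.
  destruct x as [A f c], y as [B g d]. intros H. split.
  - intros a q Hq Ha. destruct (H q Hq) as (r & Hr & [H1 _]).
    destruct (H1 a r (le_refl _ _) (le_trans _ _ _ _ Hr Ha)) as (s & Hs & b & Hb & E).
    exists s. split; [ord|eauto].
  - intros a q Hq Ha. destruct (H q Hq) as (r & Hr & [_ H1]).
    destruct (H1 a r (le_refl _ _) (le_trans _ _ _ _ Hr Ha)) as (s & Hs & b & Hb & E).
    exists s. split; [ord|eauto].
Qed.

Lemma name_mem_le x y p q : q ≤ p -> name_mem x y p -> name_mem x y q.
Proof. destruct y. apply densely_le. Qed.

Lemma name_mem_dense x y p : densely (name_mem x y) p -> name_mem x y p.
Proof. destruct y. intros H. eapply densely_bind; [exact H|]. intros; assumption. Qed.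

Lemma name_mem_eq_l x x' y p : name_eq x x' p -> name_mem x y p -> name_mem x' y p.
Proof.
  destruct y as [B g d]. intros E H. eapply densely_mono; [exact H|].
  intros q Hq (b & Hb & E'). exists b. split; auto.
  eapply name_eq_trans; [|exact E']. apply name_eq_sym. eapply name_eq_le; [exact Hq|exact E].
Qed.

Lemma name_mem_eq_r x y y' p : name_eq y y' p -> name_mem x y p -> name_mem x y' p.
Proof.
  destruct y as [B g d], y' as [B' g' d']. intros [E _] H.
  eapply densely_bind; [exact H|].
  intros q Hq (b & Hb & K) r Hr.
  destruct (E b r) as (s & Hs & b' & Hb' & K'); try ord.
  exists s. split; auto. exists b'. split; auto.
  eapply name_eq_trans; [|exact K']. eapply name_eq_le; [|exact K]. ord.
Qed.

Lemma name_mem_child A f c (a : A) p : p ≤ c a -> name_mem (f a) (mk A f c) p.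
Proof.
  intros H. apply densely_intro. intros q Hq. exists a.
  split; [ord|apply name_eq_refl].
Qed.

Lemma name_act_inv g x : name_act g (name_act (inv W g) x) = x.
Proof.
  induction x as [A f IH c]. simpl. f_equal; apply functional_extensionality.
  - exact IH.
  - intros a. apply app_inv.
Qed.

Lemma inv_act_ g x : name_act (inv W g) (name_act g x) = x.
Proof.
  induction x as [A f IH c]. simpl. f_equal; apply functional_extensionality.
  - exact IH.
  - intros a. apply inv_app.
Qed.

Lemma name_act_conj g h h' x :
  (forall p, app W h (app W g p) = app W g (app W h' p)) ->
  name_act h (name_act g x) = name_act g (name_act h' x).
Proof.
  intros E. induction x as [A f IH c]. simpl. f_equal.
  - now apply functional_extensionality.
  - apply functional_extensionality. intros a. apply E.
Qed.

Lemma name_eq_act g x y p : name_eq x y p -> name_eq (name_act g x) (name_act g y) (app W g p).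
Proof.
  revert y p. induction x as [A f IH c]. intros [B h d] p. simpl. intros [H1 H2].
  split; intros a q Hq Ha; apply le_app_inv in Hq, Ha.
  - destruct (H1 a _ Hq Ha) as (r & Hr & b & Hb & E).
    exists (app W g r). split; [now apply app_inv_le|].
    exists b. split; auto. now apply app_le.
  - destruct (H2 a _ Hq Ha) as (r & Hr & b & Hb & E).
    exists (app W g r). split; [now apply app_inv_le|].
    exists b. split; auto. now apply app_le.
Qed.

Lemma name_mem_act g x y p : name_mem x y p -> name_mem (name_act g x) (name_act g y) (app W g p).
Proof.
  destruct y as [B h d]. simpl. intros H q Hq. apply le_app_inv in Hq.
  destruct (H _ Hq) as (r & Hr & b & Hb & E).
  exists (app W g r). split; [now apply app_inv_le|].
  exists b. split; [now apply app_le|now apply name_eq_act].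
Qed.

(** Invariance is asked only up to forced equality: names built by comprehension need not be
    syntactically fixed. *)
Definition name_supported (n : nat) (x : name) : Prop :=
  forall g, fixes W n g -> forall p, name_eq (name_act g x) x p.

(** Normality: commuted past [g], an automorphism from [fixes W m] becomes one from [fixes W n],
    which [x] absorbs. *)
Lemma name_supported_act g n x : name_supported n x -> exists m, name_supported m (name_act g x).
Proof.
  intros H. destruct (fixes_conj W g n) as [m Hm]. exists m.
  intros h Hh p. destruct (Hm h Hh) as (h' & Hh' & E).
  rewrite (name_act_conj g h h') by exact E.
  rewrite <- (app_inv W g p). apply name_eq_act. now apply H.
Qed.

Fixpoint hereditarily_symmetric (x : name) : Prop :=
  match x with
  | mk A f c =>
    (exists n, name_supported n (mk A f c)) /\ forall a, hereditarily_symmetric (f a)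
  end.

Lemma hereditarily_symmetric_act g x :
  hereditarily_symmetric x -> hereditarily_symmetric (name_act g x).
Proof.
  induction x as [A f IH c]. intros [[n H] K]. split.
  - exact (name_supported_act g n _ H).
  - intros a. apply IH, K.
Qed.

(** * The universe of hereditarily symmetric names *)

Definition elt : Type := {x : name | hereditarily_symmetric x}.

Definition eqv (x y : elt) : P -> Prop := name_eq (proj1_sig x) (proj1_sig y).
Definition mem (x y : elt) : P -> Prop := name_mem (proj1_sig x) (proj1_sig y).
Definition act (g : aut W) (x : elt) : elt :=
  exist _ (name_act g (proj1_sig x)) (hereditarily_symmetric_act g _ (proj2_sig x)).
Definition supported (n : nat) (x : elt) : Prop :=
  forall g, fixes W n g -> forall p, eqv (act g x) x p.

Lemma eqv_refl x p : eqv x x p.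
Proof. apply name_eq_refl. Qed.
Lemma eqv_sym x y p : eqv x y p -> eqv y x p.
Proof. apply name_eq_sym. Qed.
Lemma eqv_trans x y z p : eqv x y p -> eqv y z p -> eqv x z p.
Proof. apply name_eq_trans. Qed.
Lemma eqv_le x y p q : q ≤ p -> eqv x y p -> eqv x y q.
Proof. apply name_eq_le. Qed.
Lemma eqv_dense x y p : densely (eqv x y) p -> eqv x y p.
Proof. apply name_eq_dense. Qed.
Lemma mem_le x y p q : q ≤ p -> mem x y p -> mem x y q.
Proof. apply name_mem_le. Qed.
Lemma mem_dense x y p : densely (mem x y) p -> mem x y p.
Proof. apply name_mem_dense. Qed.
Lemma mem_eq_l x x' y p : eqv x x' p -> mem x y p -> mem x' y p.
Proof. apply name_mem_eq_l. Qed.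
Lemma mem_eq_r x y y' p : eqv y y' p -> mem x y p -> mem x y' p.
Proof. apply name_mem_eq_r. Qed.
Lemma eqv_act g x y p : eqv x y p -> eqv (act g x) (act g y) (app W g p).
Proof. apply name_eq_act. Qed.
Lemma mem_act g x y p : mem x y p -> mem (act g x) (act g y) (app W g p).
Proof. apply name_mem_act. Qed.

Lemma elt_ext (x y : elt) : proj1_sig x = proj1_sig y -> x = y.
Proof.
  destruct x as [x Hx], y as [y Hy]. simpl. intros <-.
  f_equal. apply proof_irrelevance.
Qed.

Lemma act_inv g x : act g (act (inv W g) x) = x.
Proof. apply elt_ext, name_act_inv. Qed.
Lemma inv_act g x : act (inv W g) (act g x) = x.
Proof. apply elt_ext, inv_act_. Qed.

Lemma supported_le m n x : m <= n -> supported m x -> supported n x.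
Proof. intros Hm H g Hg. apply H. eapply fixes_le; eauto. Qed.

Lemma has_support x : exists n, supported n x.
Proof. destruct x as [[A f c] [H K]]. exact H. Qed.

(** Testing with symmetric [z] suffices because the children of a hereditarily symmetric name are
    themselves hereditarily symmetric. *)
Lemma eqv_ext x y p :
  (forall z q, q ≤ p -> (mem z x q <-> mem z y q)) -> eqv x y p.
Proof.
  destruct x as [[A f c] [Hx Kx]], y as [[B g d] [Hy Ky]]. intros H.
  split.
  - intros a q Hq Ha. apply (H (exist _ (f a) (Kx a)) q Hq); auto.
    now apply name_mem_child.
  - intros b q Hq Hb.
    destruct (proj2 (H (exist _ (g b) (Ky b)) q Hq) (name_mem_child _ _ _ _ _ Hb) q (le_refl _ _))
      as (r & Hr & a & Ha & E).
    exists r. split; auto. exists a. split; auto. now apply name_eq_sym.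
Qed.

(** * Set-sized classes and comprehension *)

Definition small (Φ : elt -> P -> Prop) : Prop :=
  exists (A : Type) (f : A -> elt),
    forall z p, Φ z p -> densely (fun q => exists a, eqv z (f a) q) p.

(** The cover is returned as data, so that the covers of all members of a family can be assembled
    into one index type. *)
Definition elements_cover x :
  {A : Type & {f : A -> elt |
    forall z p, mem z x p -> densely (fun q => exists a, eqv z (f a) q) p}}.
Proof.
  destruct x as [[A f c] H]. exists A.
  exists (fun a => exist _ (f a) (proj2 H a)).
  intros z p K. eapply densely_mono; [exact K|].
  intros q Hq (a & Ha & E). exists a. exact E.
Defined.

Lemma elements_small x : small (fun z => mem z x).
Proof. destruct (elements_cover x) as (A & f & H). exists A, f. exact H. Qed.

(** [Q] need not respect forced equality, so the induction hypothesis concerns names [x'] that are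
    densely forced equal to the member [x]. *)
Lemma mem_ind (Q : elt -> Prop) :
  (forall y, (forall x p, mem x y p -> densely (fun q => exists x', eqv x x' q /\ Q x') p) -> Q y) ->
  forall y, Q y.
Proof.
  intros H [y Hy]. induction y as [A f IH c]. apply H.
  intros x p Hx. destruct Hy as [Hy Ky].
  eapply densely_mono; [exact Hx|]. intros q Hq (a & Ha & E).
  exists (exist _ (f a) (Ky a)). split; [exact E|apply IH].
Qed.

(** The first three fields say that [Φ] behaves like a forced formula; the last makes [n] a support
    of the set it defines. *)
Record symmetric_class (n : nat) (Φ : elt -> P -> Prop) : Prop := {
  class_le : forall z p q, q ≤ p -> Φ z p -> Φ z q;
  class_dense : forall z p, densely (Φ z) p -> Φ z p;
  class_eq : forall z z' p, eqv z z' p -> Φ z p -> Φ z' p;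
  class_act : forall g, fixes W n g -> forall z p, Φ z p -> Φ (act g z) (app W g p)
}.

Lemma act_mem_class g x Φ :
  (forall z p, mem z x p <-> Φ z p) ->
  forall z p, mem z (act g x) p <-> Φ (act (inv W g) z) (app W (inv W g) p).
Proof.
  intros M z p. rewrite <- M. split; intros H.
  - apply (mem_act (inv W g)) in H. now rewrite inv_act in H.
  - apply (mem_act g) in H. now rewrite act_inv, app_inv in H.
Qed.

Lemma class_act_iff n Φ g z p :
  symmetric_class n Φ -> fixes W n g ->
  Φ (act (inv W g) z) (app W (inv W g) p) <-> Φ z p.
Proof.
  intros C Hg. split; intros H.
  - apply (class_act n Φ C g Hg) in H. now rewrite app_inv, act_inv in H.
  - apply (class_act n Φ C); auto. now apply fixes_inv.
Qed.

Lemma class_supported n x Φ :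
  symmetric_class n Φ -> (forall z p, mem z x p <-> Φ z p) -> supported n x.
Proof.
  intros C M g Hg p. apply eqv_ext. intros z q _.
  rewrite (act_mem_class g x Φ M), M. now apply (class_act_iff n).
Qed.

Lemma comprehension n Φ :
  symmetric_class n Φ -> small Φ -> exists x, forall z p, mem z x p <-> Φ z p.
Proof.
  intros C (A & f & B).
  (* All pairs of a covering element and a condition that puts it in [Φ]; the cover is what keeps
     the index type in the universe. *)
  set (I := {ap : A * P | Φ (f (fst ap)) (snd ap)}).
  set (x := mk I (fun i => proj1_sig (f (fst (proj1_sig i)))) (fun i => snd (proj1_sig i))).
  assert (M : forall z p, name_mem (proj1_sig z) x p <-> Φ z p).
  { intros z p. split.
    - intros H. apply (class_dense n Φ C). eapply densely_mono; [exact H|].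
      intros q Hq ([[a r] K] & Hr & E). simpl in *.
      apply (class_eq n Φ C (f a)); [now apply eqv_sym|].
      eapply (class_le n Φ C); [exact Hr|exact K].
    - intros H. apply (densely_mono _ _ _ (B z p H)).
      intros q Hq [a E].
      assert (K : Φ (f a) q).
      { apply (class_eq n Φ C z); auto. apply (class_le n Φ C z p); auto. }
      exists (exist _ (a, q) K). simpl. split; auto. }
  assert (Hx : hereditarily_symmetric x).
  { split; [|intros i; apply proj2_sig]. exists n. intros g Hg p. split.
    - intros [[a r] K] q Hq Hr. simpl in *.
      apply (M (act g (f a)) q); auto.
      apply (class_le n Φ C) with (p := app W g r); auto.
      now apply (class_act n Φ C).
    (* The member [f a] is pulled back along [g], where [Φ] still holds; a child matching the
       pulled-back name is then carried forward. *)
    - intros [[a r] K] q Hq Hr. simpl in *.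
      apply (class_le n Φ C _ _ q Hr), (class_act_iff n Φ g _ _ C Hg) in K.
      apply (proj2 (M (act _ _) _)), (name_mem_act g _ x) in K. simpl in K.
      rewrite app_inv, name_act_inv in K.
      destruct (K q (le_refl _ _)) as (s & Hs & i & Hi & E).
      exists s. split; auto. exists i. split; auto. now apply name_eq_sym. }
  exists (exist _ x Hx). exact M.
Qed.

(** The index may change from [i] to [j] under [g]; this covers families that automorphisms
    permute. *)
Lemma class_exists n (I : Type) (Ψ : I -> elt -> P -> Prop) :
  (forall i z p q, q ≤ p -> Ψ i z p -> Ψ i z q) ->
  (forall i z z' p, eqv z z' p -> Ψ i z p -> Ψ i z' p) ->
  (forall i g, fixes W n g -> forall z p, Ψ i z p -> exists j, Ψ j (act g z) (app W g p)) ->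
  symmetric_class n (fun z => densely (fun q => exists i, Ψ i z q)).
Proof.
  intros Hle Heq Hact. split.
  - intros z p q. apply densely_le.
  - intros z p H. eapply densely_bind; [exact H|auto].
  - intros z z' p E H. eapply densely_mono; [exact H|].
    intros q Hq [i K]. exists i. apply (Heq i z); auto. eapply eqv_le; [exact Hq|exact E].
  - intros g Hg z p H. apply (densely_inv g) in H.
    eapply densely_mono; [exact H|]. intros q Hq [i K].
    apply (Hact i g Hg) in K. now rewrite app_inv in K.
Qed.

(** * Forcing and soundness *)

Definition econs (x : elt) (ρ : nat -> elt) (n : nat) : elt :=
  match n with 0 => x | S m => ρ m end.
Notation "x ;; ρ" := (econs x ρ) (at level 55, right associativity).

(** No double negations are needed: [⊥], [⟶] and [∀] preserve regular openness. *)
Fixpoint forces (ρ : nat -> elt) (φ : form) (p : P) : Prop :=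
  match φ with
  | Bot => False
  | Mem x y => mem (ρ x) (ρ y) p
  | Eq x y => eqv (ρ x) (ρ y) p
  | Imp φ ψ => forall q, q ≤ p -> forces ρ φ q -> forces ρ ψ q
  | All φ => forall x, forces (x ;; ρ) φ p
  end.

Lemma forces_le ρ φ p q : q ≤ p -> forces ρ φ p -> forces ρ φ q.
Proof.
  revert ρ. induction φ; simpl; intros ρ Hq H; auto.
  - eapply mem_le; eauto.
  - eapply eqv_le; eauto.
  - intros r Hr. apply H. ord.
Qed.

Local Ltac mono := solve [eapply forces_le; [|eassumption]; ord].

(** Forced formulas are regular open sets of conditions, which is what validates proof by
    contradiction. *)
Lemma forces_dense ρ φ p : densely (forces ρ φ) p -> forces ρ φ p.
Proof.
  revert ρ p. induction φ as [| | |φ _ ψ IH|φ IH]; simpl; intros ρ p H.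
  - destruct (H p (le_refl _ _)) as (r & _ & []).
  - now apply mem_dense.
  - now apply eqv_dense.
  - intros q Hq Hφ. apply IH. apply (densely_le _ _ _ Hq) in H.
    eapply densely_mono; [exact H|]. intros r Hr K. apply K; auto.
    mono.
  - intros x. apply IH. eapply densely_mono; [exact H|]. auto.
Qed.

Lemma forces_eq ρ ρ' φ p :
  (forall n, eqv (ρ n) (ρ' n) p) -> forces ρ φ p -> forces ρ' φ p.
Proof.
  revert ρ ρ' p. induction φ as [|x y|x y|φ IH1 ψ IH2|φ IH]; simpl; intros ρ ρ' p E H.
  - exact H.
  - eapply mem_eq_l; [apply E|]. eapply mem_eq_r; [apply E|exact H].
  - eapply eqv_trans; [|apply E]. eapply eqv_trans; [|exact H]. now apply eqv_sym.
  - intros q Hq K.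
    assert (E' : forall n, eqv (ρ n) (ρ' n) q) by (intros n; eapply eqv_le; [exact Hq|apply E]).
    apply (IH2 ρ); auto. apply H; auto. apply (IH1 ρ'); auto.
    intros n. now apply eqv_sym.
  - intros x. apply (IH (x ;; ρ)); auto. intros [|n]; simpl; auto. apply eqv_refl.
Qed.

Lemma forces_ext ρ ρ' φ p :
  (forall n, ρ n = ρ' n) -> forces ρ φ p <-> forces ρ' φ p.
Proof. intros E. now rewrite (functional_extensionality ρ ρ' E). Qed.

Lemma econs_map (h : elt -> elt) x ρ :
  (fun n => h ((x ;; ρ) n)) = (h x ;; fun n => h (ρ n)).
Proof. apply functional_extensionality. now intros [|n]. Qed.

(** The symmetry lemma; the quantifier case uses that [act g] is onto. *)
Lemma forces_act g ρ φ p :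
  forces ρ φ p <-> forces (fun n => act g (ρ n)) φ (app W g p).
Proof.
  revert ρ p. induction φ as [|x y|x y|φ IH1 ψ IH2|φ IH]; simpl; intros ρ p.
  - tauto.
  - split; [apply mem_act|]. intros H. apply (mem_act (inv W g)) in H.
    now rewrite !inv_act, inv_app in H.
  - split; [apply eqv_act|]. intros H. apply (eqv_act (inv W g)) in H.
    now rewrite !inv_act, inv_app in H.
  - split; intros H q Hq K.
    + rewrite <- (app_inv W g q) in K |- *. apply (IH2 ρ). apply H; [|now apply IH1].
      now apply le_app_inv.
    + apply (IH2 ρ). apply H; [now apply app_le|]. now apply (IH1 ρ).
  - split; intros H x.
    + rewrite <- (act_inv g x), <- (econs_map (act g)).
      apply (IH (_ ;; ρ)), H.
    + apply (IH (x ;; ρ)). rewrite econs_map. apply H.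
Qed.

Lemma forces_subst r ρ φ p :
  forces ρ (subst r φ) p <-> forces (fun n => ρ (r n)) φ p.
Proof.
  revert r ρ p. induction φ as [|x y|x y|φ IH1 ψ IH2|φ IH]; simpl; intros r ρ p; try tauto.
  - split; intros H q Hq K; apply IH2, H, IH1; auto.
  - assert (E : forall x, (fun n => (x ;; ρ) (scons 0 (fun n => S (r n)) n))
                          = (x ;; fun n => ρ (r n))).
    { intros x. apply functional_extensionality. now intros [|n]. }
    split; intros H x; specialize (H x).
    + now rewrite IH, E in H.
    + now rewrite IH, E.
Qed.

Lemma forces_neg ρ φ p : forces ρ (Neg φ) p <-> forall q, q ≤ p -> ~ forces ρ φ q.
Proof. reflexivity. Qed.

Lemma forces_all ρ φ p : forces ρ (All φ) p <-> forall x, forces (x ;; ρ) φ p.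
Proof. reflexivity. Qed.

Lemma forces_and ρ φ ψ p : forces ρ (And φ ψ) p <-> forces ρ φ p /\ forces ρ ψ p.
Proof.
  split.
  - intros H. split; apply forces_dense; intros q Hq; apply NNPP; intros K;
      apply (H q Hq); intros r Hr H1 s Hs H2; apply K; exists s;
      (split; [ord|auto]). mono.
  - intros [H1 H2] q Hq K. apply (K q (le_refl _ _)) with q; auto; mono.
Qed.

Lemma densely_NNPP Q p : (forall q, q ≤ p -> ~ forall r, r ≤ q -> ~ Q r) -> densely Q p.
Proof.
  intros H q Hq. apply NNPP. intros K. apply (H q Hq). intros r Hr HQ.
  apply K. eauto.
Qed.

Lemma forces_or ρ φ ψ p :
  forces ρ (Or φ ψ) p <-> densely (fun q => forces ρ φ q \/ forces ρ ψ q) p.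
Proof.
  split.
  - intros H. apply densely_NNPP. intros q Hq K. apply (K q); auto. right.
    apply H; auto. intros r Hr H1. apply (K r); auto.
  - intros H q Hq K. apply forces_dense. apply (densely_le _ _ _ Hq) in H.
    eapply densely_mono; [exact H|]. intros r Hr [H1|H1]; auto.
    now destruct (K r Hr).
Qed.

Lemma forces_ex ρ φ p :
  forces ρ (Ex φ) p <-> densely (fun q => exists x, forces (x ;; ρ) φ q) p.
Proof.
  split.
  - intros H. apply densely_NNPP. intros q Hq K. apply (H q Hq).
    intros x r Hr H1. apply (K r Hr). eauto.
  - intros H q Hq K. destruct (H q Hq) as (r & Hr & x & H1).
    apply (K x r Hr H1).
Qed.

Lemma forces_iff ρ φ ψ p :
  forces ρ (Iff φ ψ) p <-> forall q, q ≤ p -> (forces ρ φ q <-> forces ρ ψ q).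
Proof.
  unfold Iff. rewrite forces_and. split.
  - intros [H1 H2] q Hq. split; [apply H1|apply H2]; auto.
  - intros H. split; intros q Hq; apply H; auto.
Qed.

(** Environments in which every element has the same support; quantification over those is
    what the rule [AllI] needs, and it makes formulas define symmetric classes. *)
Definition bounded (ρ : nat -> elt) : Prop := exists n, forall k, supported n (ρ k).

Lemma bounded_econs x ρ : bounded ρ -> bounded (x ;; ρ).
Proof.
  intros [n Hn]. destruct (has_support x) as [m Hm]. exists (n + m).
  intros [|k]; simpl.
  - apply (supported_le m); [lia|exact Hm].
  - apply (supported_le n); [lia|apply Hn].
Qed.

Lemma soundness Γ φ : prv Γ φ -> forall ρ p, bounded ρ ->
  (forall ψ, In ψ Γ -> forces ρ ψ p) -> forces ρ φ p.
Proof.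
  induction 1 as [Γ φ H|Γ φ ψ _ IH|Γ φ ψ _ IH1 _ IH2|Γ φ _ IH|Γ φ _ IH|Γ φ x _ IH|Γ x
    |Γ φ x y _ IH1 _ IH2]; intros ρ p B HΓ.
  - auto.
  - intros q Hq K. apply IH; auto. intros χ [<-|Hχ]; auto.
    apply (forces_le ρ χ p); auto.
  - apply (IH1 ρ p B HΓ p); [auto|]. now apply IH2.
  (* If [φ] is not forced densely, some [q] has no extension forcing [φ], hence [q] forces its
     negation. *)
  - apply forces_dense, densely_NNPP. intros q Hq K. apply (IH ρ q); auto.
    intros χ [<-|Hχ]; auto. apply (forces_le ρ χ p); auto.
  - intros x. apply IH; [now apply bounded_econs|]. intros ψ Hψ.
    apply in_map_iff in Hψ as (χ & <- & Hχ). apply forces_subst. simpl. auto.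
  - rewrite forces_subst. specialize (IH ρ p B HΓ (ρ x)).
    eapply forces_eq; [|exact IH]. intros [|n]; apply eqv_refl.
  - apply eqv_refl.
  - rewrite forces_subst in *. specialize (IH2 ρ p B HΓ). rewrite forces_subst in IH2.
    eapply forces_eq; [|exact IH2]. intros [|n]; [now apply (IH1 ρ p)|apply eqv_refl].
Qed.

Definition valid (φ : form) : Prop := forall ρ p, bounded ρ -> forces ρ φ p.

Lemma valid_closure φ : valid φ -> valid (closure φ).
Proof.
  intros H. unfold closure. induction (fv_bound φ) as [|n IH]; auto.
  intros ρ p B x. apply IH. now apply bounded_econs.
Qed.

(** A derivation of ⊥ would make [p] force ⊥, which is [False]; [x] fills the environment. *)
Lemma valid_consistent (T : theory) (p : P) (x : elt) :
  (forall φ, T φ -> valid φ) -> consistent T.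
Proof.
  intros H (Γ & HΓ & K). destruct (has_support x) as [n Hn].
  apply (soundness _ _ K (fun _ => x) p).
  - now exists n.
  - intros ψ Hψ. apply H; auto. now exists n.
Qed.

(** Automorphisms in [fixes W n] may move [z] but fix all parameters at once, by their common
    support. *)
Lemma forces_class n ρ φ :
  (forall k, supported n (ρ k)) -> symmetric_class n (fun z => forces (z ;; ρ) φ).
Proof.
  intros B. split.
  - intros z p q. apply forces_le.
  - intros z p. apply forces_dense.
  - intros z z' p E. apply forces_eq. intros [|k]; simpl; auto. apply eqv_refl.
  - intros g Hg z p H. apply (forces_act g) in H. rewrite econs_map in H.
    eapply forces_eq; [|exact H]. intros [|k]; simpl; [apply eqv_refl|].
    now apply B.
Qed.

Lemma class_iff n (Φ Ψ : elt -> P -> Prop) :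
  (forall z p, Φ z p <-> Ψ z p) -> symmetric_class n Φ -> symmetric_class n Ψ.
Proof.
  intros E C. split.
  - intros z p q Hq H. apply E in H. apply E. exact (class_le n Φ C z p q Hq H).
  - intros z p H. apply E, (class_dense n Φ C). eapply densely_mono; [exact H|].
    intros q _. apply E.
  - intros z z' p Hz H. apply E in H. apply E. exact (class_eq n Φ C z z' p Hz H).
  - intros g Hg z p H. apply E in H. apply E. exact (class_act n Φ C g Hg z p H).
Qed.

Lemma forces_comprehension ρ φ :
  bounded ρ -> small (fun z => forces (z ;; ρ) φ) ->
  exists x, forall z p, mem z x p <-> forces (z ;; ρ) φ p.
Proof.
  intros [n B] H. apply (comprehension n); auto. now apply forces_class.
Qed.

Lemma small_incl (Φ Ψ : elt -> P -> Prop) :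
  (forall z p, Φ z p -> Ψ z p) -> small Ψ -> small Φ.
Proof. intros H (A & f & K). exists A, f. auto. Qed.

Lemma forces_separation ρ φ a :
  bounded ρ -> exists x, forall z p, mem z x p <-> mem z a p /\ forces (z ;; ρ) φ p.
Proof.
  intros B.
  (* [a] joins the environment so that membership in it becomes part of the formula; the
     substitution lets [φ] skip over it. *)
  destruct (forces_comprehension (a ;; ρ) (And (Mem 0 1) (subst (scons 0 (fun n => S (S n))) φ)))
    as [x Hx].
  - now apply bounded_econs.
  - apply small_incl with (2 := elements_small a). intros z p H.
    now apply forces_and in H.
  - exists x. intros z p. rewrite Hx, forces_and, forces_subst. simpl.
    rewrite (forces_ext _ (z ;; ρ)); [tauto|now intros [|n]].
Qed.

(** * The axioms of ZF *)

#[local] Instance densely_iff :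
  Proper (pointwise_relation P iff ==> eq ==> iff) densely.
Proof.
  intros Q R H p _ <-. split; intros K; eapply densely_mono; try exact K; firstorder.
Qed.

Local Opaque Neg And Or Iff Ex.
Local Ltac unfold_forces :=
  cbn [forces];
  repeat (match goal with
    | |- context [Iff] => setoid_rewrite forces_iff
    | |- context [And] => setoid_rewrite forces_and
    | |- context [Or] => setoid_rewrite forces_or
    | |- context [Ex] => setoid_rewrite forces_ex
    | |- context [Neg] => setoid_rewrite forces_neg
    end; cbn [forces]);
  cbn [forces econs Nat.add].

Lemma valid_ext : valid ax_ext.
Proof.
  intros ρ p _. unfold ax_ext. unfold_forces. intros x y q Hq H.
  apply eqv_ext. exact H.
Qed.

Lemma valid_found : valid ax_found.
Proof.
  intros ρ p _. unfold ax_found. unfold_forces. intros x q Hq H.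
  apply densely_NNPP. intros q' Hq' K.
  (* If no condition below [q'] forces a member of [x] to be minimal, induction along membership
     shows that [x] has no members there at all. *)
  assert (N : forall y r, r ≤ q' -> ~ mem y x r).
  { intros y. induction y as [y IH] using mem_ind. intros r Hr Hy.
    apply (K r Hr). exists y. split; auto. intros s Hs D.
    destruct (D s (le_refl _ _)) as (t & Ht & z & Hz & Hzy).
    destruct (IH z t Hzy t (le_refl _ _)) as (u & Hu & z' & E & Hz').
    apply (Hz' u); [ord|]. apply (mem_eq_l z); auto. eapply mem_le; eauto. }
  destruct (H q' Hq') as (r & Hr & y & Hy). exact (N y r Hr Hy).
Qed.

Lemma valid_pair : valid ax_pair.
Proof.
  intros ρ p B. unfold ax_pair, is_pair. unfold_forces. intros x y.
  destruct (forces_comprehension (y ;; x ;; ρ) (Or (Eq 0 1) (Eq 0 2))) as [z Hz].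
  - now repeat apply bounded_econs.
  - exists bool, (fun b : bool => if b then x else y). intros z q H.
    apply forces_or in H. eapply densely_mono; [exact H|].
    intros r _ [K|K]; [exists false|exists true]; exact K.
  - apply densely_intro. intros q Hq. exists z. setoid_rewrite forces_or in Hz.
    cbn in Hz. intros w r Hr. rewrite Hz.
    split; intros K; (eapply densely_mono; [exact K|]); cbn; tauto.
Qed.

Lemma valid_union : valid ax_union.
Proof.
  intros ρ p B. unfold ax_union, is_union. unfold_forces. intros x.
  destruct (forces_comprehension (x ;; ρ) (Ex (And (Mem 0 2) (Mem 1 0)))) as [z Hz].
  - now apply bounded_econs.
  - destruct (elements_cover x) as (A & f & Hf).
    (* Indices are pairs of an index of a member of [x] and an index in the cover of that member. *)
    exists {a : A & projT1 (elements_cover (f a))},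
      (fun i => proj1_sig (projT2 (elements_cover (f (projT1 i)))) (projT2 i)).
    intros w q H. apply forces_ex in H. eapply densely_bind; [exact H|].
    intros r _ [y Hy]. apply forces_and in Hy as [Hy Hw]. cbn in Hy, Hw.
    eapply densely_bind; [exact (Hf _ _ Hy)|]. intros s Hs [a E].
    assert (Hw' : mem w (f a) s).
    { apply (mem_eq_r w y); auto. eapply mem_le; eauto. }
    eapply densely_mono; [exact (proj2_sig (projT2 (elements_cover (f a))) _ _ Hw')|].
    intros t _ [b E']. exists (existT _ a b). exact E'.
  - apply densely_intro. intros q Hq. exists z.
    intros w r Hr. rewrite Hz. unfold_forces. reflexivity.
Qed.

Definition subset (x y : elt) (p : P) : Prop :=
  forall z q, q ≤ p -> mem z x q -> mem z y q.

(** Up to forced equality, a subset of [x] is determined by its trace: which conditions put which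
    covering elements into it. Traces form a type, so one chosen name per realized trace covers the
    power set. *)
Lemma power_exists (x : elt) : exists y, forall z p, mem z y p <-> subset z x p.
Proof.
  assert (B : bounded (fun _ => x)) by (destruct (has_support x) as [n Hn]; now exists n).
  apply (forces_comprehension (fun _ => x) (is_subset 0 1)); auto.
  destruct (elements_cover x) as (A & f & Hf).
  set (trace := fun y a q => mem (f a) y q).
  set (good := fun y => forall w q, mem w y q -> mem w x q).
  exists {X : A -> P -> Prop | exists y, good y /\ trace y = X},
    (fun X => proj1_sig (constructive_indefinite_description
      (fun y => good y /\ trace y = proj1_sig X) (proj2_sig X))).
  intros w q H. apply densely_intro. intros r Hr.
  (* [w] is known to be a subset of [x] only below [q]; intersecting it with [x] gives a subset at
     all conditions. *)
  destruct (forces_separation (fun _ => x) (Mem 0 1) w) as [y Hy]; auto.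
  cbn in Hy.
  assert (Gy : good y) by (intros v s Hv; now apply Hy in Hv).
  exists (exist _ (trace y) (ex_intro _ y (conj Gy eq_refl))). cbn.
  destruct (constructive_indefinite_description _ _) as (y' & Gy' & E). cbn.
  assert (T : forall a s, mem (f a) y' s <-> mem (f a) y s).
  { intros a s. change (trace y' a s <-> trace y a s). now rewrite E. }
  assert (Sub : forall v v', good v -> (forall a s, mem (f a) v s -> mem (f a) v' s) ->
    forall u s, mem u v s -> mem u v' s).
  { intros v v' Gv I u s Hu. apply mem_dense. eapply densely_mono; [exact (Hf _ _ (Gv _ _ Hu))|].
    intros t Ht [a Ea]. apply (mem_eq_l (f a)); [now apply eqv_sym|]. apply I.
    apply (mem_eq_l u); auto. eapply mem_le; eauto. }
  apply eqv_ext. intros v s Hs. split; intros K.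
  + apply (Sub y); auto; [firstorder|]. apply Hy. split; auto. apply (H v s); [ord|auto].
  + apply (Sub y' y) in K; auto; [|firstorder]. now apply Hy in K.
Qed.

Lemma valid_power : valid ax_power.
Proof.
  intros ρ p _. unfold ax_power, is_power, is_subset. unfold_forces. intros x.
  destruct (power_exists x) as [y Hy].
  apply densely_intro. intros q _. exists y. intros z r _. apply Hy.
Qed.

Lemma valid_sep φ : valid (ax_sep φ).
Proof.
  apply valid_closure. intros ρ p B. unfold_forces. intros a.
  destruct (forces_separation ρ φ a B) as [b Hb].
  apply densely_intro. intros q Hq. exists b. intros z r Hr. rewrite Hb, forces_subst.
  apply and_iff_compat_l, forces_ext. now intros [|n].
Qed.

Lemma valid_repl φ : valid (ax_repl φ).
Proof.
  apply valid_closure. intros ρ p B q Hq F a.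
  set (Func := All (All (All (Imp _ _)))) in F.
  destruct (elements_cover a) as (A & f & Hf).
  assert (Fun : forall x y y' r, forces ρ Func r -> forces (x ;; y ;; ρ) φ r ->
    forces (x ;; y' ;; ρ) φ r -> eqv y y' r).
  { intros x y y' r K H1 H2. apply (K x y y' r (le_refl _ _)).
    apply forces_and. rewrite !forces_subst.
    split; [eapply forces_eq; [|exact H1]|eapply forces_eq; [|exact H2]];
      intros [|[|n]]; apply eqv_refl. }
  (* Functionality is forced at [q] only, while smallness concerns all conditions, so [Func] is made
     part of the formula. *)
  destruct (forces_comprehension (a ;; ρ)
    (And (subst (fun n => 2 + n) Func)
      (Ex (And (Mem 0 2) (subst (scons 0 (scons 1 (fun n => 3 + n))) φ))))) as [b Hb].
  - now apply bounded_econs.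
  (* One value is chosen for each covering element of [a] and each condition that forces some value;
     functionality makes it equal to any other value. *)
  - exists {i : A * P | exists y, forces (f (fst i) ;; y ;; ρ) φ (snd i)},
      (fun i => proj1_sig (constructive_indefinite_description
        (fun y => forces (f (fst (proj1_sig i)) ;; y ;; ρ) φ (snd (proj1_sig i))) (proj2_sig i))).
    intros y r H. apply forces_and in H as [K H]. rewrite forces_subst in K.
    change (forces ρ Func r) in K. apply forces_ex in H.
    eapply densely_bind; [exact H|]. intros s Hs [x H1].
    apply forces_and in H1 as [Hx H1]. rewrite forces_subst in H1. cbn in Hx.
    eapply densely_mono; [exact (Hf _ _ Hx)|]. intros t Ht [i E].
    assert (H2 : forces (f i ;; y ;; ρ) φ t).
    { eapply forces_eq; [|eapply forces_le; [exact Ht|exact H1]].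
      intros [|[|n]]; [exact E|apply eqv_refl..]. }
    exists (exist _ (i, t) (ex_intro _ y H2)). cbn.
    destruct (constructive_indefinite_description _ _) as [y' Hy']. cbn.
    apply (Fun (f i)); auto. apply (forces_le ρ Func r); [ord|exact K].
  - apply forces_ex, densely_intro. intros r Hr. exists b. intros y.
    apply forces_iff. intros s Hs. cbn. rewrite Hb, forces_and, forces_subst.
    rewrite !forces_ex.
    assert (E : forall x t,
      forces (x ;; y ;; a ;; ρ) (And (Mem 0 2) (subst (scons 0 (scons 1 (fun n => 3 + n))) φ)) t
      <-> forces (x ;; y ;; b ;; a ;; ρ)
            (And (Mem 0 3) (subst (scons 0 (scons 1 (fun n => 4 + n))) φ)) t).
    { intros x t. rewrite !forces_and, !forces_subst.
      apply and_iff_compat_l, forces_ext. now intros [|[|n]]. }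
    setoid_rewrite E. split; [tauto|]. intros H. split; auto.
    apply (forces_le ρ Func q); [ord|exact F].
Qed.

(** * Numerals and ω *)

Lemma empty_exists : exists x : elt, forall z p, ~ mem z x p.
Proof.
  destruct (comprehension 0 (fun (_ : elt) _ => False)) as [x Hx].
  - split; try tauto. intros z p H. now destruct (H p (le_refl _ _)) as (r & _ & []).
  - exists False, (fun i : False => match i with end). tauto.
  - exists x. intros z p H. now apply Hx in H.
Qed.

Lemma succ_exists (y : elt) :
  exists x, forall z p, mem z x p <-> forces (z ;; fun _ => y) (Or (Mem 0 1) (Eq 0 1)) p.
Proof.
  apply forces_comprehension.
  - destruct (has_support y) as [n Hn]. now exists n.
  - destruct (elements_cover y) as (A & f & Hf).
    exists (option A), (fun o => match o with None => y | Some a => f a end).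
    intros z p H. apply forces_or in H. eapply densely_bind; [exact H|].
    intros q _ [K|K].
    + eapply densely_mono; [exact (Hf _ _ K)|]. intros r _ [a E]. now exists (Some a).
    + apply densely_intro. intros r Hr. exists None. eapply eqv_le; [exact Hr|exact K].
Qed.

Definition zero : elt := proj1_sig (constructive_indefinite_description _ empty_exists).
Definition succ (y : elt) : elt :=
  proj1_sig (constructive_indefinite_description _ (succ_exists y)).
Fixpoint num (n : nat) : elt := match n with 0 => zero | S m => succ (num m) end.

Lemma mem_zero z p : ~ mem z zero p.
Proof. unfold zero. destruct (constructive_indefinite_description _ _); simpl. auto. Qed.

Lemma mem_succ_forces y z p :
  mem z (succ y) p <-> forces (z ;; fun _ => y) (Or (Mem 0 1) (Eq 0 1)) p.
Proof. unfold succ. destruct (constructive_indefinite_description _ _); simpl. auto. Qed.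

Lemma mem_succ y z p : mem z (succ y) p <-> densely (fun q => mem z y q \/ eqv z y q) p.
Proof. rewrite mem_succ_forces. unfold_forces. reflexivity. Qed.

Lemma num_supported n k : supported n (num k).
Proof.
  induction k as [|k IH]; simpl.
  - intros g _ p. apply eqv_ext. intros z q _. split; intros H.
    + apply (mem_act (inv W g)) in H. rewrite inv_act in H. now apply mem_zero in H.
    + now apply mem_zero in H.
  - eapply class_supported; [|apply mem_succ_forces]. apply forces_class. auto.
Qed.

Lemma mem_num z n p :
  mem z (num n) p <-> densely (fun q => exists m, m < n /\ eqv z (num m) q) p.
Proof.
  revert p. induction n as [|n IH]; intros p; simpl.
  - split; intros H; [now apply mem_zero in H|].
    destruct (H p (le_refl _ _)) as (r & _ & m & Hm & _). lia.
  - rewrite mem_succ. split; intros H; (eapply densely_bind; [exact H|]).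
    + intros q _ [K|K].
      * apply IH in K. eapply densely_mono; [exact K|].
        intros r _ (m & Hm & E). exists m. split; [lia|auto].
      * apply densely_intro. intros r Hr. exists n. split; [lia|].
        eapply eqv_le; [exact Hr|exact K].
    + intros q _ (m & Hm & E). apply densely_intro. intros r Hr.
      assert (E' : eqv z (num m) r) by (eapply eqv_le; [exact Hr|exact E]).
      destruct (Nat.eq_dec m n) as [->|]; auto. left. apply IH, densely_intro.
      intros s Hs. exists m. split; [lia|]. eapply eqv_le; [exact Hs|exact E'].
Qed.

Lemma num_lt m n p : m < n -> mem (num m) (num n) p.
Proof.
  intros H. apply mem_num, densely_intro. intros q _. exists m. split; auto.
  apply eqv_refl.
Qed.

Lemma num_irrefl n p : ~ mem (num n) (num n) p.
Proof.
  revert p. induction n as [n IH] using lt_wf_ind. intros p H.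
  apply mem_num in H. destruct (H p (le_refl _ _)) as (q & _ & m & Hm & E).
  apply (IH m Hm q). apply (mem_eq_r (num m) (num n)); auto. now apply num_lt.
Qed.

Lemma num_inj m n p : eqv (num m) (num n) p -> m = n.
Proof.
  intros E. destruct (lt_eq_lt_dec m n) as [[H|H]|H]; auto; exfalso.
  - apply (num_irrefl m p). apply (mem_eq_r _ (num n)); [now apply eqv_sym|].
    now apply num_lt.
  - apply (num_irrefl n p). apply (mem_eq_r _ (num m)); [auto|].
    now apply num_lt.
Qed.

Lemma forces_inductive ρ x p :
  forces ρ (is_inductive x) p <->
  mem zero (ρ x) p /\ forall y q, q ≤ p -> mem y (ρ x) q -> mem (succ y) (ρ x) q.
Proof.
  unfold is_inductive, is_empty, is_succ. unfold_forces. split; intros [H1 H2]; split.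
  - apply mem_dense. eapply densely_mono; [exact H1|]. intros q _ (z & Hz & K).
    apply (mem_eq_l z); auto. apply eqv_ext. intros w r Hr.
    split; intros Hw; [now apply Hz in Hw|now apply mem_zero in Hw].
  - intros y q Hq Hy. specialize (H2 y q Hq Hy). apply mem_dense.
    eapply densely_mono; [exact H2|]. intros r _ (z & Hz & K).
    apply (mem_eq_l z); auto. apply eqv_ext. intros w s Hs. now rewrite (Hz w s Hs), mem_succ.
  - apply densely_intro. intros q Hq. exists zero. split; [|eapply mem_le; eauto].
    intros w r _ H. now apply mem_zero in H.
  - intros y q Hq Hy. apply densely_intro. intros r Hr. exists (succ y).
    split; [|eapply mem_le; eauto]. intros w s _. apply mem_succ.
Qed.

Lemma omega_exists :
  exists w : elt, forall z p, mem z w p <-> densely (fun q => exists n, eqv z (num n) q) p.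
Proof.
  apply (comprehension 0).
  - apply class_exists with (Ψ := fun n z p => eqv z (num n) p).
    + intros n z p q. apply eqv_le.
    + intros n z z' p E H. eapply eqv_trans; [apply eqv_sym, E|exact H].
    + intros n g Hg z p E. exists n. eapply eqv_trans; [apply eqv_act, E|].
      now apply (num_supported 0).
  - exists nat, num. auto.
Qed.

Lemma omega_inductive w p :
  (forall z p, mem z w p <-> densely (fun q => exists n, eqv z (num n) q) p) ->
  mem zero w p /\ forall y q, q ≤ p -> mem y w q -> mem (succ y) w q.
Proof.
  intros Hw. split.
  - apply Hw, densely_intro. intros q _. exists 0. apply eqv_refl.
  - intros y q _ Hy. apply Hw in Hy. apply Hw.
    eapply densely_mono; [exact Hy|]. intros r _ [n E]. exists (S n). simpl.
    apply eqv_ext. intros z s Hs. rewrite !mem_succ.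
    assert (E' : eqv y (num n) s) by (eapply eqv_le; [exact Hs|exact E]).
    split; intros H; (eapply densely_mono; [exact H|]); cbn;
      intros t Ht [K|K]; (assert (E2 : eqv y (num n) t) by (eapply eqv_le; [exact Ht|exact E']));
      [left|right|left|right].
    + eapply mem_eq_r; eauto.
    + eapply eqv_trans; eauto.
    + eapply mem_eq_r; [apply eqv_sym|]; eauto.
    + eapply eqv_trans; [eauto|]. now apply eqv_sym.
Qed.

Lemma valid_inf : valid ax_inf.
Proof.
  intros ρ p _. apply forces_ex, densely_intro. intros q _.
  destruct omega_exists as [w Hw]. exists w. apply forces_inductive.
  now apply omega_inductive.
Qed.

Lemma valid_ZF φ : ZF φ -> valid φ.
Proof.
  intros []; [exact valid_ext|exact valid_found|exact valid_pair|exact valid_union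
    |exact valid_power|exact valid_inf|apply valid_sep|apply valid_repl].
Qed.

(** Leastness, tested against the set from [omega_exists], bounds the members by numerals;
    inductiveness supplies every numeral. Functions on ω can thus be evaluated at actual natural
    numbers. *)
Lemma forces_omega ρ w p :
  forces ρ (is_omega w) p -> forall z q, q ≤ p ->
  (mem z (ρ w) q <-> densely (fun r => exists n, eqv z (num n) r) q).
Proof.
  intros H z q Hq. apply forces_and in H as [H1 H2]. split; intros Hz.
  - destruct omega_exists as [o Ho].
    apply Ho. apply (H2 o p) with (q := q); auto.
    apply forces_inductive. now apply omega_inductive.
  - apply forces_inductive in H1 as [H0 HS].
    assert (N : forall n r, r ≤ p -> mem (num n) (ρ w) r).
    { induction n as [|n IH]; intros r Hr; [eapply mem_le; eauto|]. simpl.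
      apply (HS (num n)); auto. }
    apply mem_dense. eapply densely_mono; [exact Hz|]. intros r Hr [n E].
    apply (mem_eq_l (num n)); [now apply eqv_sym|]. apply N. ord.
Qed.

(** * Functions and ultrafilters *)

Definition pairing (z x y : elt) (p : P) : Prop :=
  forall w q, q ≤ p -> (mem w z q <-> densely (fun r => eqv w x r \/ eqv w y r) q).

Definition opair (e x y : elt) (p : P) : Prop :=
  densely (fun q => exists s t, pairing s x x q /\ pairing t x y q /\ pairing e s t q) p.

Definition maps (f x y : elt) (p : P) : Prop :=
  densely (fun q => exists e, opair e x y q /\ mem e f q) p.

Lemma forces_opair ρ e x y p :
  forces ρ (is_opair e x y) p <-> opair (ρ e) (ρ x) (ρ y) p.
Proof.
  unfold is_opair, is_pair, opair. unfold_forces. split; intros H.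
  - eapply densely_bind; [exact H|]. intros q _ [s K].
    eapply densely_mono; [exact K|]. intros r _ [t L]. exists s, t. exact L.
  - eapply densely_mono; [exact H|]. intros q _ (s & t & K1 & K2 & K3). exists s.
    apply densely_intro. intros r Hr. exists t. split; [|split]; intros w u Hu.
    + apply K1. ord.
    + apply K2. ord.
    + apply K3. ord.
Qed.

Lemma forces_maps ρ f x y p :
  forces ρ (maps_to f x y) p <-> maps (ρ f) (ρ x) (ρ y) p.
Proof.
  unfold maps_to, maps. rewrite forces_ex. apply densely_iff; [|reflexivity].
  intros q. split; intros [e K]; exists e; revert K; now rewrite forces_and, forces_opair.
Qed.

Lemma pairing_le z x y p q : q ≤ p -> pairing z x y p -> pairing z x y q.
Proof. intros Hq H w r Hr. apply H. ord. Qed.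

Lemma pairing_l z x y p : pairing z x y p -> mem x z p.
Proof. intros H. apply (H x p); auto. apply densely_intro. left. apply eqv_refl. Qed.

Lemma pairing_r z x y p : pairing z x y p -> mem y z p.
Proof. intros H. apply (H y p); auto. apply densely_intro. right. apply eqv_refl. Qed.

Lemma pairing_mem z x y w p q :
  q ≤ p -> pairing z x y p -> mem w z q -> densely (fun r => eqv w x r \/ eqv w y r) q.
Proof. intros Hq H. now apply H. Qed.

Lemma singleton_mem z x w p : pairing z x x p -> mem w z p -> eqv w x p.
Proof.
  intros H K. apply eqv_dense. apply (H w p) in K; auto.
  eapply densely_mono; [exact K|]. cbn. tauto.
Qed.

(** The usual argument for Kuratowski pairs, each case distinction passing to a stronger
    condition. *)
Lemma opair_inj e x y x' y' p :
  opair e x y p -> opair e x' y' p -> eqv x x' p /\ eqv y y' p.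
Proof.
  intros H H'.
  assert (D : densely (fun q => eqv x x' q /\ eqv y y' q) p).
  { eapply densely_bind; [exact H|]. intros q Hq (s & t & Hs & Ht & He).
    eapply densely_bind; [exact (densely_le _ _ _ Hq H')|].
    intros r Hr (s' & t' & Hs' & Ht' & He').
    apply (pairing_le _ _ _ _ _ Hr) in Hs, Ht, He. clear q Hq Hr.
    (* The singleton of [x] is one of the two members of the other representation, and both of these
       contain [x']. *)
    assert (X : eqv x x' r).
    { apply eqv_sym, eqv_dense.
      eapply densely_mono; [exact (pairing_mem _ _ _ _ _ _ (le_refl _ _) He' (pairing_l _ _ _ _ He))|].
      intros u Hu K. apply (singleton_mem s); [now apply (pairing_le _ _ _ _ _ Hu)|].
      destruct K as [K|K].
      - apply (mem_eq_r _ s'); [now apply eqv_sym|].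
        apply (pairing_l _ _ x'). now apply (pairing_le _ _ _ _ _ Hu).
      - apply (mem_eq_r _ t'); [now apply eqv_sym|].
        apply (pairing_l _ _ y'). now apply (pairing_le _ _ _ _ _ Hu). }
    assert (Y : eqv y y' r).
    { apply eqv_dense.
      eapply densely_bind; [exact (pairing_mem _ _ _ _ _ _ (le_refl _ _) He' (pairing_r _ _ _ _ He))|].
      intros u Hu K. apply (pairing_le _ _ _ _ _ Hu) in Hs, Ht, He, Hs', Ht', He'.
      apply (eqv_le _ _ _ _ Hu) in X. clear r Hu. destruct K as [K|K].
      (* Here {x, y} = {x'}, so all four components coincide. *)
      - assert (Yx : eqv y x' u).
        { apply (singleton_mem s'); auto. apply (mem_eq_r _ t); auto.
          now apply (pairing_r _ x). }
        eapply densely_mono;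
          [exact (pairing_mem _ _ _ _ _ _ (le_refl _ _) He (pairing_r _ _ _ _ He'))|].
        intros v Hv L. apply (pairing_le _ _ _ _ _ Hv) in Hs, Ht, Hs', Ht'.
        apply (eqv_le _ _ _ _ Hv) in X, Yx, K.
        apply (eqv_trans _ x'); auto. apply eqv_sym. destruct L as [L|L].
        + apply (eqv_trans _ x); auto. apply (singleton_mem s); auto.
          apply (mem_eq_r _ t'); auto. now apply (pairing_r _ x').
        + apply (singleton_mem s'); auto. apply (mem_eq_r _ t); auto.
          apply (mem_eq_r _ t'); auto. now apply (pairing_r _ x').
      - assert (M : mem y t' u).
        { apply (mem_eq_r _ t); auto. now apply (pairing_r _ x). }
        assert (M' : mem y' t u).
        { apply (mem_eq_r _ t'); [now apply eqv_sym|]. now apply (pairing_r _ x'). }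
        eapply densely_bind; [exact (pairing_mem _ _ _ _ _ _ (le_refl _ _) Ht' M)|].
        intros v Hv [L|L].
        + eapply densely_mono; [exact (pairing_mem _ _ _ _ _ _ Hv Ht (mem_le _ _ _ _ Hv M'))|].
          intros z Hz [N|N]; [|now apply eqv_sym].
          apply (eqv_le _ _ _ _ Hz) in L. apply (eqv_trans _ x'); auto. apply eqv_sym.
          apply (eqv_trans _ x); auto. eapply eqv_le; [|exact X]. ord.
        + apply densely_intro. intros z Hz. eapply eqv_le; [exact Hz|exact L]. }
    apply densely_intro. intros u Hu. split; eapply eqv_le; eauto. }
  split; apply eqv_dense; (eapply densely_mono; [exact D|]); cbn; tauto.
Qed.

Lemma forces_function ρ f d c p :
  forces ρ (is_function f d c) p ->
  (forall x q, q ≤ p -> mem x (ρ d) q -> densely (fun r => exists y, maps (ρ f) x y r) q)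
  /\ (forall x y q, q ≤ p -> maps (ρ f) x y q -> mem y (ρ c) q)
  /\ (forall x y y' q, q ≤ p -> maps (ρ f) x y q -> maps (ρ f) x y' q -> eqv y y' q).
Proof.
  intros H. apply forces_and in H as [H1 H]. apply forces_and in H as [H2 H3].
  split; [|split].
  - intros x q Hq Hx. specialize (H2 x q Hq Hx). apply forces_ex in H2.
    eapply densely_mono; [exact H2|]. intros r _ [y K]. exists y. now apply forces_maps in K.
  - intros x y q Hq H. apply mem_dense. eapply densely_bind; [exact H|].
    intros r Hr (e & He & Ke). assert (Hrp : r ≤ p) by ord.
    specialize (H1 e r Hrp Ke). apply forces_ex in H1.
    eapply densely_bind; [exact H1|]. intros s Hs [x' K]. apply forces_ex in K.
    eapply densely_mono; [exact K|]. intros t Ht [y' L].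
    apply forces_and in L as [_ L]. apply forces_and in L as [L1 L2].
    apply forces_opair in L2. cbn in L1, L2.
    apply (mem_eq_l y'); auto. refine (proj2 (opair_inj _ _ _ _ _ _ L2 _)).
    eapply densely_le; [|exact He]. ord.
  - intros x y y' q Hq K K'. apply (H3 x y y' q Hq). apply forces_and.
    rewrite !forces_maps. now split.
Qed.

Lemma maps_le f x y p q : q ≤ p -> maps f x y p -> maps f x y q.
Proof. apply densely_le. Qed.

Lemma subset_le (x y : elt) p q : q ≤ p -> subset x y p -> subset x y q.
Proof. intros Hq H z r Hr. apply H. ord. Qed.

Lemma subset_dense (x y : elt) p : densely (subset x y) p -> subset x y p.
Proof.
  intros H z q Hq Hz. apply mem_dense. apply (densely_le _ _ _ Hq) in H.
  eapply densely_mono; [exact H|]. intros r Hr K. apply K; auto. eapply mem_le; eauto.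
Qed.

Definition ultrafilter (u x : elt) (p : P) : Prop :=
  (forall y q, q ≤ p -> mem y u q -> subset y x q)
  /\ mem x u p
  /\ (forall y q, q ≤ p -> (forall z r, r ≤ q -> ~ mem z y r) -> ~ mem y u q)
  /\ (forall y z q, q ≤ p -> mem y u q -> subset y z q -> subset z x q -> mem z u q)
  /\ (forall y z c q, q ≤ p -> mem y u q -> mem z u q ->
       (forall a r, r ≤ q -> (mem a c r <-> mem a y r /\ mem a z r)) -> mem c u q)
  /\ (forall y z q, q ≤ p -> subset y x q ->
       (forall a r, r ≤ q -> (mem a z r <-> mem a x r /\ forall s, s ≤ r -> ~ mem a y s)) ->
       densely (fun r => mem y u r \/ mem z u r) q).

Lemma forces_ultrafilter ρ u x p :
  forces ρ (is_ultrafilter u x) p <-> ultrafilter (ρ u) (ρ x) p.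
Proof.
  unfold is_ultrafilter, is_filter, is_diff, is_inter, is_empty, is_subset.
  unfold ultrafilter, subset.
  unfold_forces. split.
  - intros ((H1 & H2 & H3 & H4 & H5) & H6). repeat apply conj; auto.
    + intros y q Hq K. now apply (H3 y q).
    + intros y z q Hq K1 K2 K3. now apply (H4 y z q).
    + intros y z c q Hq K1 K2 K3. now apply (H5 y z c q).
  - intros (H1 & H2 & H3 & H4 & H5 & H6). repeat apply conj; auto.
    + intros y q Hq K r Hr. apply H3; [ord|]. intros z s Hs. apply K. ord.
    + intros y z q Hq (K1 & K2 & K3). now apply (H4 y z q).
    + intros y z c q Hq (K1 & K2 & K3). now apply (H5 y z c q).
    + intros y z q Hq (K1 & K2). now apply H6.
Qed.

Lemma inter_exists (x y : elt) :
  exists z, forall a p, mem a z p <-> mem a x p /\ mem a y p.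
Proof.
  destruct (has_support y) as [n Hn].
  destruct (forces_separation (fun _ => y) (Mem 0 1) x) as [z Hz]; [now exists n|].
  exists z. intros a p. apply Hz.
Qed.

Lemma diff_exists (x y : elt) :
  exists z, forall a p, mem a z p <-> mem a x p /\ forall q, q ≤ p -> ~ mem a y q.
Proof.
  destruct (has_support y) as [n Hn].
  destruct (forces_separation (fun _ => y) (Neg (Mem 0 1)) x) as [z Hz]; [now exists n|].
  exists z. intros a p. apply Hz.
Qed.

Lemma eqv_act_incl g (x y : elt) :
  (forall z p, mem z x p -> mem (act g z) y (app W g p)) ->
  (forall z p, mem z y p -> mem (act (inv W g) z) x (app W (inv W g) p)) ->
  forall p, eqv (act g x) y p.
Proof.
  intros H K p. apply eqv_ext. intros z q _.
  rewrite (act_mem_class g x (fun z => mem z x)) by reflexivity.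
  split; [|apply K]. intros L. apply H in L. now rewrite act_inv, app_inv in L.
Qed.

End Forcing.

Notation "x ;; ρ" := (econs x ρ) (at level 55, right associativity).

(** * The Cohen system *)

(** Conditions are encoded as total functions with [None] for an undecided bit; one bound [N] serves
    both coordinates. *)
Definition finite_support (c : nat -> nat -> option bool) : Prop :=
  exists N, forall i n, N <= i \/ N <= n -> c i n = None.

Definition pcond : Type := {c | finite_support c}.
Definition val (p : pcond) : nat -> nat -> option bool := proj1_sig p.
Definition extends (q p : pcond) : Prop :=
  forall i n b, val p i n = Some b -> val q i n = Some b.

Lemma pcond_ext (p q : pcond) : (forall i n, val p i n = val q i n) -> p = q.
Proof.
  destruct p as [c Hc], q as [d Hd]. simpl. intros E.
  assert (c = d) as <-.
  { apply functional_extensionality. intros i. apply functional_extensionality, E. }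
  f_equal. apply proof_irrelevance.
Qed.

(** Flips are unrestricted, so a generic real can be complemented from some bit on; the finite
    support of [perm] bounds the index shift in the proof of normality and on the cofinite
    filter. *)
Record flip_perm : Type := {
  perm : nat -> nat;
  perm_inv : nat -> nat;
  flip : nat -> nat -> bool;
  perm_perm_inv : forall i, perm (perm_inv i) = i;
  perm_inv_perm : forall i, perm_inv (perm i) = i;
  perm_finite : exists B, forall i, B <= i -> perm i = i
}.

Lemma perm_inv_fix g i : perm g i = i -> perm_inv g i = i.
Proof. intros E. rewrite <- E at 1. apply perm_inv_perm. Qed.

(** [g] sends the [i]-th generic real to the [perm g i]-th one, with bits flipped along [flip g]. *)
Definition pact (g : flip_perm) (p : pcond) : pcond.
Proof.
  exists (fun i n => option_map (xorb (flip g i n)) (val p (perm_inv g i) n)).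
  destruct p as [c [N HN]], (perm_finite g) as [B HB]. exists (N + B).
  intros i n H. simpl. rewrite HN; auto. destruct H as [H|H]; [left|right; lia].
  rewrite (perm_inv_fix g); [lia|]. apply HB. lia.
Defined.

Lemma val_pact g p i n :
  val (pact g p) i n = option_map (xorb (flip g i n)) (val p (perm_inv g i) n).
Proof. reflexivity. Qed.

Definition flip_perm_inv (g : flip_perm) : flip_perm.
Proof.
  refine {| perm := perm_inv g; perm_inv := perm g; flip := fun i n => flip g (perm g i) n;
    perm_perm_inv := perm_inv_perm g; perm_inv_perm := perm_perm_inv g |}.
  destruct (perm_finite g) as [B HB]. exists B. intros i Hi. apply perm_inv_fix, HB, Hi.
Defined.

Definition flip_perm_mul (g h : flip_perm) : flip_perm.
Proof.
  refine {| perm := fun i => perm g (perm h i); perm_inv := fun i => perm_inv h (perm_inv g i);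
    flip := fun i n => xorb (flip g i n) (flip h (perm_inv g i) n) |}.
  - intros i. now rewrite !perm_perm_inv.
  - intros i. now rewrite !perm_inv_perm.
  - destruct (perm_finite g) as [B HB], (perm_finite h) as [C HC]. exists (B + C).
    intros i Hi. rewrite HC, HB; lia.
Defined.

Lemma pact_inv g p : pact g (pact (flip_perm_inv g) p) = p.
Proof.
  apply pcond_ext. intros i n. rewrite !val_pact. simpl. rewrite perm_perm_inv.
  destruct (val p i n) as [b|]; simpl; auto. now destruct b, (flip g i n).
Qed.

Lemma inv_pact g p : pact (flip_perm_inv g) (pact g p) = p.
Proof.
  apply pcond_ext. intros i n. rewrite !val_pact. simpl. rewrite perm_inv_perm.
  destruct (val p i n) as [b|]; simpl; auto. now destruct b, (flip g (perm g i) n).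
Qed.

Lemma pact_mul g h p : pact (flip_perm_mul g h) p = pact g (pact h p).
Proof.
  apply pcond_ext. intros i n. rewrite !val_pact. simpl.
  destruct (val p _ n) as [b|]; simpl; auto. now rewrite xorb_assoc.
Qed.

Definition pfixes (n : nat) (g : flip_perm) : Prop :=
  forall i, i < n -> perm g i = i /\ forall k, flip g i k = false.

Lemma pfixes_conj g n : exists m, forall h, pfixes m h ->
  exists h', pfixes n h' /\ forall p, pact h (pact g p) = pact g (pact h' p).
Proof.
  destruct (perm_finite g) as [B HB]. exists (n + B). intros h Hh.
  exists (flip_perm_mul (flip_perm_inv g) (flip_perm_mul h g)). split.
  - intros i Hi. assert (L : perm g i < n + B).
    (* An image that is at least [n + B] would be a fixed point of [perm g], so by injectivity it
       would be [i] itself. *)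
    { destruct (le_lt_dec (n + B) (perm g i)) as [L|L]; auto.
      assert (E : perm g (perm g i) = perm g i) by (apply HB; lia).
      apply (f_equal (perm_inv g)) in E. rewrite !perm_inv_perm in E. lia. }
    destruct (Hh _ L) as [E F]. split; simpl.
    + rewrite E. apply perm_inv_perm.
    + intros k. rewrite F, (perm_inv_fix h) by exact E. now destruct (flip g _ k).
  - intros p. now rewrite !pact_mul, pact_inv.
Qed.

Lemma extends_refl p : extends p p.
Proof. intros i n b H. exact H. Qed.

Lemma extends_trans p q r : extends p q -> extends q r -> extends p r.
Proof. intros H K i n b L. apply H, K, L. Qed.

Lemma pact_extends g p q : extends p q -> extends (pact g p) (pact g q).
Proof.
  intros H i n b. rewrite !val_pact.
  destruct (val q _ n) as [c|] eqn:E; [|discriminate]. now rewrite (H _ _ _ E).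
Qed.

Lemma pfixes_le m n g : m <= n -> pfixes n g -> pfixes m g.
Proof. intros Hm H i Hi. apply H. lia. Qed.

Lemma pfixes_inv n g : pfixes n g -> pfixes n (flip_perm_inv g).
Proof.
  intros H i Hi. destruct (H i Hi) as [E F]. simpl. split.
  - now apply perm_inv_fix.
  - intros k. rewrite E. apply F.
Qed.

Definition cohen : symmetric_system := {|
  cond := pcond; le := extends; le_refl := extends_refl; le_trans := extends_trans;
  aut := flip_perm; app := pact; inv := flip_perm_inv; app_inv := pact_inv;
  inv_app := inv_pact; app_le := pact_extends;
  fixes := pfixes; fixes_le := pfixes_le; fixes_inv := pfixes_inv; fixes_conj := pfixes_conj
|}.

Canonical cohen.

Notation "p ≤ q" := (le cohen p q) (at level 70, no associativity).

Definition update (p : pcond) (i n : nat) (b : bool) : pcond.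
Proof.
  exists (fun j m => if (i =? j) && (n =? m) then Some b else val p j m).
  destruct p as [c [N HN]]. exists (N + S i + S n). intros j m H. simpl.
  destruct (Nat.eqb_spec i j), (Nat.eqb_spec n m); simpl; try (apply HN); lia.
Defined.

Lemma update_le p i n b : val p i n = None -> update p i n b ≤ p.
Proof.
  intros H j m c. simpl.
  destruct (Nat.eqb_spec i j), (Nat.eqb_spec n m); simpl; auto. subst. congruence.
Qed.

Lemma val_update p i n b : val (update p i n b) i n = Some b.
Proof. simpl. now rewrite !Nat.eqb_refl. Qed.

Lemma undecided (p : pcond) : exists N, forall i n, N <= n -> val p i n = None.
Proof. destruct p as [c [N HN]]. exists N. intros i n H. apply HN. now right. Qed.

Definition weakest : pcond.
Proof. exists (fun _ _ => None). now exists 0. Defined.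

Local Ltac ord := solve [eauto using le_trans, le_refl].

Notation cohen_elt := (@elt cohen).

(** * Completeness of ultrafilters *)

(** [z ∈ f(k)] *)
Definition in_value (f : cohen_elt) (k : nat) (z : cohen_elt) (p : pcond) : Prop :=
  forall y q, q ≤ p -> maps f (num k) y q -> mem z y q.

(** [k] is forced to be the value at [z] of the map that pushes [u] forward to ω. *)
Definition first_failure (f : cohen_elt) (k : nat) (z : cohen_elt) (p : pcond) : Prop :=
  (forall q, q ≤ p -> ~ in_value f k z q) /\ forall j, j < k -> in_value f j z p.

(** A formula with parameters [num k] and [f] expresses [in_value], so [forces_class] gives all
    closure properties. *)
Lemma in_value_class m f k :
  supported m f -> symmetric_class m (in_value f k).
Proof.
  intros Hf.
  eapply class_iff; [|apply (forces_class m (num k ;; fun _ => f)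
    (All (Imp (maps_to 3 2 0) (Mem 1 0))))].
  - intros z p. split; intros H y q Hq K; apply H; auto;
      now apply forces_maps in K || apply forces_maps.
  - intros [|j]; [apply num_supported|exact Hf].
Qed.

Lemma first_failure_le f k z p q : q ≤ p -> first_failure f k z p -> first_failure f k z q.
Proof.
  intros Hq [H1 H2]. split.
  - intros r Hr. apply H1. ord.
  - intros j Hj y r Hr. apply H2; auto. ord.
Qed.

Lemma first_failure_eq f k z z' p :
  eqv z z' p -> first_failure f k z p -> first_failure f k z' p.
Proof.
  destruct (has_support f) as [m Hm]. intros E [H1 H2]. split.
  - intros q Hq H. apply (H1 q Hq).
    apply (class_eq m _ (in_value_class m f k Hm) z'); auto.
    apply eqv_sym. eapply eqv_le; [exact Hq|exact E].
  - intros j Hj. apply (class_eq m _ (in_value_class m f j Hm) z); auto.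
Qed.

Lemma first_failure_act m f k g z p :
  supported m f -> pfixes m g ->
  first_failure f k z p -> first_failure f k (act g z) (pact g p).
Proof.
  intros Hf Hg [H1 H2]. split.
  - intros q Hq H. apply (H1 (pact (flip_perm_inv g) q)); [now apply (le_app_inv g p q)|].
    apply (class_act m _ (in_value_class m f k Hf) (flip_perm_inv g)) in H;
      [|now apply (fixes_inv cohen)].
    now rewrite (inv_act (W := cohen) g) in H.
  - intros j Hj. now apply (class_act m _ (in_value_class m f j Hf)), H2.
Qed.

Lemma first_failure_unique f k k' z p :
  first_failure f k z p -> first_failure f k' z p -> k = k'.
Proof.
  intros [H1 H2] [K1 K2]. destruct (lt_eq_lt_dec k k') as [[L|L]|L]; auto; exfalso.
  - exact (H1 p (le_refl _ _) (K2 k L)).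
  - exact (K1 p (le_refl _ _) (H2 k' L)).
Qed.

(** Strong induction: below a condition forcing failure at [k], either [k] is the first failure or
    membership is not forced at some earlier index. *)
Lemma first_failure_exists f k z p :
  ~ in_value f k z p -> exists j q, q ≤ p /\ first_failure f j z q.
Proof.
  revert p. induction k as [k IH] using lt_wf_ind. intros p H.
  destruct (has_support f) as [m Hm].
  assert (D : exists q, q ≤ p /\ forall r, r ≤ q -> ~ in_value f k z r).
  { apply NNPP. intros D. apply H, (class_dense m _ (in_value_class m f k Hm)).
    intros q Hq. apply NNPP. intros D'. apply D. exists q. split; auto.
    intros r Hr K. apply D'. eauto. }
  destruct D as (q & Hq & D).
  destruct (classic (forall j, j < k -> in_value f j z q)) as [K|K].
  - exists k, q. split; auto. now split.
  - apply not_all_ex_not in K as [j K]. apply imply_to_and in K as [Hj K].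
    destruct (IH j Hj q K) as (i & r & Hr & F). exists i, r. split; auto. ord.
Qed.

Definition flip_above (m N : nat) : flip_perm.
Proof.
  refine {| perm := fun i => i; perm_inv := fun i => i;
    flip := fun i n => (i =? m) && (N <=? n) |}; auto.
  now exists 0.
Defined.

Lemma flip_above_fixes m N : pfixes m (flip_above m N).
Proof. intros i Hi. split; auto. intros k. simpl. now destruct (Nat.eqb_spec i m); [lia|]. Qed.

Lemma flip_above_fix m N p :
  (forall n, N <= n -> val p m n = None) -> pact (flip_above m N) p = p.
Proof.
  intros H. apply pcond_ext. intros i n. rewrite val_pact. simpl.
  destruct (Nat.eqb_spec i m) as [->|]; simpl; [|now destruct (val p i n)].
  destruct (Nat.leb_spec N n); [now rewrite H|now destruct (val p m n)].
Qed.

Section Completeness.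

Context (x u f : cohen_elt) (p : pcond) (m : nat)
  (Sx : supported m x) (Su : supported m u) (Sf : supported m f)
  (HU : ultrafilter u x p)
  (Hval : forall k q, q ≤ p -> densely (fun r => exists y, maps f (num k) y r) q)
  (Hrng : forall z y q, q ≤ p -> maps f z y q -> mem y u q)
  (Hfun : forall z y y' q, q ≤ p -> maps f z y q -> maps f z y' q -> eqv y y' q).

(** On [c] a first failure cannot occur before [N]; this plays the part of the pushed ultrafilter
    having only infinite members. *)
Lemma finite_intersection N q : q ≤ p -> exists c r, r ≤ q /\ mem c u r /\
  forall z s, s ≤ r -> mem z c s -> forall k, k < N -> in_value f k z s.
Proof.
  destruct HU as (_ & Ux & _ & _ & Ui & _).
  intros Hq. induction N as [|N (c & r & Hr & Hc & H)].
  - exists x, q. split; [ord|]. split; [eapply mem_le; eauto|]. lia.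
  - destruct (Hval N r) with (q := r) as (s & Hs & y & Hy); [ord|ord|].
    destruct (inter_exists c y) as [d Hd]. exists d, s. split; [ord|]. split.
    + apply (Ui c y); [ord|eapply mem_le; eauto|eapply Hrng; eauto; ord|auto].
    + intros z t Ht Hz k Hk. apply Hd in Hz as [Hz1 Hz2].
      destruct (Nat.eq_dec k N) as [->|].
      * intros y' v Hv Hy'. apply (mem_eq_r z y); [|eapply mem_le; eauto].
        apply (Hfun (num N)); auto; [ord|]. eapply maps_le; [|exact Hy]. ord.
      * apply (H z t); auto; [ord|lia].
Qed.

(** [z ∈ x] lies outside the intersection, and the [m]-th generic real contains the least [k]
    with [z ∉ f(k)]. *)
Definition halving (k : nat) (z : cohen_elt) (q : pcond) : Prop :=
  mem z x q /\ first_failure f k z q /\ val q m k = Some true.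

(** The support is [S m] because the set depends on the [m]-th generic real; flips of that real fix
    [x], [u] and [f] but can move this set. *)
Lemma halving_exists :
  exists y : cohen_elt, forall z q, mem z y q <-> densely (fun r => exists k, halving k z r) q.
Proof.
  apply (comprehension (S m)).
  - apply class_exists with (Ψ := halving).
    + intros k z q r Hr (H1 & H2 & H3). split; [eapply mem_le; eauto|].
      split; [eapply first_failure_le; eauto|]. now apply Hr.
    + intros k z z' q E (H1 & H2 & H3). split; [eapply mem_eq_l; eauto|].
      split; [eapply first_failure_eq; eauto|auto].
    + intros k g Hg z q (H1 & H2 & H3). exists k.
      assert (Hg' : pfixes m g) by (intros i Hi; apply Hg; lia). split; [|split].
      * apply (mem_act g) in H1. eapply mem_eq_r; [|exact H1]. now apply Sx.
      * now apply (first_failure_act m).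
      * destruct (Hg m) as [E F]; [lia|].
        change (val (pact g q) m k = Some true).
        now rewrite val_pact, (perm_inv_fix g m E), F, H3.
  - eapply small_incl; [|exact (elements_small x)]. intros z q H. cbn.
    apply mem_dense. eapply densely_mono; [exact H|]. intros r _ (k & K & _). exact K.
Qed.

Lemma intersection_large b :
  (forall z q, q ≤ p -> mem z x q -> (forall k, in_value f k z q) -> mem z b q) ->
  (forall z q, q ≤ p -> mem z b q -> mem z x q) ->
  mem b u p.
Proof.
  intros Hb Hbx. destruct HU as (Usub & Ux & Une & Uup & Ui & Ud).
  (* Otherwise some [q] has no extension forcing [b] into [u]; below it, the complement of [b] and
     one half of a partition of [x] get into [u]. *)
  apply mem_dense, densely_NNPP. intros q Hq K.
  destruct halving_exists as [y Hy].
  destruct (diff_exists x b) as [b' Hb'], (diff_exists x y) as [y' Hy'].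
  assert (Hyx : forall z q, mem z y q -> mem z x q).
  { intros z r H. apply Hy in H. apply mem_dense.
    eapply densely_mono; [exact H|]. intros s _ (k & L & _). exact L. }
  destruct (Ud b b' q) with (q := q) as (q1 & Hq1 & [Hbu|Hb'u]); auto; try ord.
  { intros z r Hr. apply Hbx. ord. }
  { exact (K q1 Hq1 Hbu). }
  destruct (Ud y y' q1) with (q := q1) as (q2 & Hq2 & HY); auto; try ord.
  { intros z r _. apply Hyx. }
  (* The flip starts beyond every bit decided by [q2], so it fixes [q2] as well as [u], and the
     image of the chosen half also lies in [u]. *)
  destruct (undecided q2) as [N HN]. pose (g := flip_above m N).
  assert (Gq : pact g q2 = q2) by (apply flip_above_fix; auto).
  assert (Gu : forall a, mem a u q2 -> mem (act g a) u q2).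
  { intros a Ha. apply (mem_act (W := cohen) g) in Ha.
    change (app cohen g q2) with (pact g q2) in Ha.
    rewrite Gq in Ha. eapply mem_eq_r; [|exact Ha]. apply Su, flip_above_fixes. }
  destruct (finite_intersection N q2) as (c & q3 & Hq3 & Hc & HcN); [ord|].
  destruct HY as [HY|HY].
  (* A point common to [y], [act g y] and [c] has a first failure [k >= N], whose bit would be true
     both before and after the flip. *)
  - destruct (inter_exists y (act g y)) as [d1 Hd1], (inter_exists d1 c) as [d Hd].
    assert (Hdu : mem d u q3).
    { apply (Ui d1 c); [ord| |exact Hc|auto].
      apply (Ui y (act g y)); [ord|eapply mem_le; eauto
        |eapply mem_le; [|apply Gu, HY]; ord|auto]. }
    revert Hdu. apply Une; [ord|]. intros z t Ht Hz.
    apply Hd in Hz as [Hz Hzc]. apply Hd1 in Hz as [Hzy Hzg].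
    apply Hy in Hzy. destruct (Hzy t (le_refl _ _)) as (v & Hv & k & _ & Fk & Vk).
    apply (mem_act (inv cohen g)) in Hzg. rewrite inv_act in Hzg. apply Hy in Hzg.
    destruct (Hzg (pact (flip_perm_inv g) v)) as (s & Hs & k' & _ & Fk' & Vk').
    { now apply (app_le cohen (flip_perm_inv g)). }
    apply (first_failure_act m f k' g) in Fk'; [|exact Sf|apply flip_above_fixes].
    rewrite (act_inv (W := cohen) g) in Fk'.
    assert (Hgs : pact g s ≤ v) by now apply (app_inv_le (W := cohen) g v s).
    assert (k' = k) as ->.
    { eapply first_failure_unique; [exact Fk'|]. eapply first_failure_le; eauto. }
    assert (L : N <= k).
    { destruct (le_lt_dec N k) as [L|L]; auto. exfalso.
      refine (proj1 Fk v (le_refl _ _) _). apply HcN; auto; [ord|].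
      eapply mem_le; eauto. }
    apply Hgs in Vk. rewrite val_pact in Vk. cbn [g flip_above perm_inv] in Vk.
    rewrite Vk' in Vk. simpl in Vk. rewrite Nat.eqb_refl in Vk.
    apply Nat.leb_le in L. rewrite L in Vk. discriminate.
  (* Intersecting with [b'] as well guarantees that a point has a first failure at all. *)
  - destruct (inter_exists y' (act g y')) as [d1 Hd1], (inter_exists c b') as [d2 Hd2],
      (inter_exists d1 d2) as [d Hd].
    assert (Hdu : mem d u q3).
    { apply (Ui d1 d2); [ord| | |auto].
      - apply (Ui y' (act g y')); [ord|eapply mem_le; eauto
        |eapply mem_le; [|apply Gu, HY]; ord|auto].
      - apply (Ui c b'); [ord|exact Hc|eapply mem_le; [|exact Hb'u]; ord|auto]. }
    revert Hdu. apply Une; [ord|]. intros z t Ht Hz.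
    apply Hd in Hz as [Hz Hz2]. apply Hd1 in Hz as [Hzy Hzg]. apply Hd2 in Hz2 as [Hzc Hzb].
    apply Hb' in Hzb as [Hzx Hzb]. apply Hy' in Hzy as [_ Hzy].
    apply (mem_act (inv cohen g)) in Hzg. rewrite inv_act in Hzg.
    apply Hy' in Hzg as [_ Hzg].
    assert (F : exists k, ~ in_value f k z t).
    { apply not_all_ex_not. intros F. apply (Hzb t (le_refl _ _)). apply Hb; auto. ord. }
    destruct F as [k0 F]. destruct (first_failure_exists f k0 z t F) as (k & v & Hv & Fk).
    assert (L : N <= k).
    { destruct (le_lt_dec N k) as [L|L]; auto. exfalso.
      refine (proj1 Fk v (le_refl _ _) _). apply HcN; auto; [ord|].
      eapply mem_le; eauto. }
    assert (Hzv : mem z x v) by (eapply mem_le; eauto).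
    assert (T : forall v', v' ≤ t -> halving k z v' -> False).
    { intros v' Hv' Hh. apply (Hzy v' Hv'). apply Hy, densely_intro.
      intros r Hr. exists k. destruct Hh as (H1 & H2 & H3).
      split; [eapply mem_le; eauto|]. split; [eapply first_failure_le; eauto|now apply Hr]. }
    (* A true bit puts [z] in [y], a false one puts it in [act g y], and an undecided one can be set
       to true. *)
    destruct (val v m k) as [[|]|] eqn:Vk.
    + apply (T v Hv). now split.
    + apply (Hzg (pact (flip_perm_inv g) v)).
      { now apply (app_le cohen (flip_perm_inv g)). }
      apply Hy, densely_intro. intros r Hr. exists k.
      assert (Gi : pfixes m (flip_perm_inv g)) by (apply pfixes_inv, flip_above_fixes).
      split; [|split].
      * eapply mem_le; [exact Hr|]. apply (mem_act (inv cohen g)) in Hzv.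
        eapply mem_eq_r; [|exact Hzv]. now apply Sx.
      * eapply first_failure_le; [exact Hr|]. now apply (first_failure_act m).
      * apply Hr. rewrite val_pact. cbn [flip_perm_inv perm_inv flip g flip_above perm].
        rewrite Vk. simpl. rewrite Nat.eqb_refl. apply Nat.leb_le in L. now rewrite L.
    + apply (T (update v m k true)).
      { eapply le_trans; [|exact Hv]. now apply update_le. }
      assert (Hu : update v m k true ≤ v) by now apply update_le.
      split; [eapply mem_le; eauto|]. split; [eapply first_failure_le; eauto|].
      apply val_update.
Qed.

End Completeness.

Lemma valid_sigma_complete : valid (W := cohen) every_ultrafilter_sigma_complete.
Proof.
  intros ρ p0 B x u p _ HU w f q Hq H.
  apply forces_ultrafilter in HU. cbn [econs] in HU. apply forces_and in H as [Hw Hf].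
  pose proof (forces_omega _ _ _ Hw) as Ho. cbn [econs] in Ho.
  apply forces_function in Hf as (Hdom & Hrng & Hfun). cbn [econs] in Hdom, Hrng, Hfun.
  assert (HUq : ultrafilter u x q).
  { destruct HU as (H1 & H2 & H3 & H4 & H5 & H6). repeat apply conj; intros.
    - apply (H1 y q0); auto. ord.
    - eapply mem_le; eauto.
    - apply H3; auto. ord.
    - apply (H4 y z q0); auto. ord.
    - apply (H5 y z c q0); auto. ord.
    - apply H6; auto. ord. }
  clear HU p0 p B Hq Hw.
  destruct (has_support x) as [m1 S1], (has_support u) as [m2 S2],
    (has_support f) as [m3 S3], (has_support w) as [m4 S4].
  (* The formula defining the intersection in [is_sigma_complete], with the indices of [f] and [w]
     lowered by one since the intersection itself is not in the environment. *)
  pose (φ := All (All (Imp (And (Mem 1 4) (maps_to 3 1 0)) (Mem 2 0)))).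
  destruct (forces_separation (f ;; w ;; fun _ => x) φ x) as [b Hb].
  { now do 2 apply bounded_econs; exists m1. }
  (* Quantifying over the internal ω amounts to quantifying over numerals. *)
  assert (Hφ : forall z r, r ≤ q ->
    forces (z ;; f ;; w ;; fun _ => x) φ r <-> forall k, in_value f k z r).
  { intros z r Hr. split.
    - intros H k y s Hs Hy. apply (H (num k) y s Hs). apply forces_and. split.
      + apply (Ho (num k) s); [ord|]. apply densely_intro. intros t _. exists k. apply eqv_refl.
      + now apply forces_maps.
    - intros H n y s Hs K. apply forces_and in K as [K1 K2]. cbn [forces econs] in K1.
      apply Ho in K1; [|ord]. apply mem_dense. eapply densely_mono; [exact K1|].
      intros t Ht [k E]. apply (H k y t); [ord|].
      apply (forces_maps (num k ;; y ;; z ;; f ;; w ;; fun _ => x) 3 0 1).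
      apply (forces_le _ _ _ _ Ht) in K2.
      apply forces_maps in K2. cbn [econs] in K2.
      apply (forces_maps (n ;; y ;; z ;; f ;; w ;; fun _ => x) 3 0 1) in K2.
      eapply forces_eq; [|exact K2]. intros [|j]; [exact E|apply eqv_refl]. }
  (* Separation from [x] loses nothing: a point of all values lies in [f(0)], a member of [u] and so
     a subset of [x]. *)
  assert (Hsub : forall z r, r ≤ q -> mem z b r <-> forces (z ;; f ;; w ;; fun _ => x) φ r).
  { intros z r Hr. rewrite Hb. split; [tauto|]. intros H. split; auto.
    rewrite Hφ in H by exact Hr.
    assert (D : densely (fun s => exists y, maps f (num 0) y s) r).
    { apply (Hdom (num 0) r Hr), Ho; auto. apply densely_intro. intros s _.
      exists 0. apply eqv_refl. }
    apply mem_dense. eapply densely_mono; [exact D|]. intros s Hs [y Hy].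
    destruct HUq as (U1 & _). apply (U1 y s); [ord| |ord|].
    - apply (Hrng (num 0) y); [ord|exact Hy].
    - apply (H 0 y s Hs Hy). }
  apply forces_ex, densely_intro. intros r Hr. exists b. apply forces_and. split.
  - eapply mem_le; [exact Hr|].
    apply (intersection_large x u f q (m1 + m2 + m3)); auto.
    + apply (supported_le m1); auto. lia.
    + apply (supported_le m2); auto. lia.
    + apply (supported_le m3); auto. lia.
    + intros k s Hs. apply Hdom; auto. apply Ho; auto. apply densely_intro.
      intros t _. exists k. apply eqv_refl.
    + intros z s Hs _ H. apply Hsub; auto. now apply Hφ.
    + intros z s _ H. now apply Hb in H.
  - intros z. apply forces_iff. intros s Hs. cbn [forces econs]. rewrite Hsub by ord.
    unfold φ. split; intros H n y t Ht K; apply forces_and in K as [K1 K2];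
      apply (H n y t Ht), forces_and; (split; [exact K1|]);
      apply forces_maps in K2; now apply forces_maps.
Qed.
(** * A non-principal ultrafilter *)

(** [n] belongs to the symmetric difference exactly when its bit differs from [X n], hence the
    [negb]. Functions [nat -> bool] are the ground-model reals. *)
Lemma real_exists i (X : nat -> bool) : exists x : cohen_elt, forall z p, mem z x p <->
  densely (fun q => exists n, eqv z (num n) q /\ val q i n = Some (negb (X n))) p.
Proof.
  apply (comprehension (S i)).
  - apply class_exists with (Ψ := fun n z q => eqv z (num n) q /\ val q i n = Some (negb (X n))).
    + intros n z p q Hq [E V]. split; [eapply eqv_le; eauto|now apply Hq].
    + intros n z z' p E [E' V]. split; auto. eapply eqv_trans; [apply eqv_sym, E|exact E'].
    + intros n g Hg z p [E V]. exists n. destruct (Hg i) as [Ei Fi]; [lia|]. split.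
      * eapply eqv_trans; [apply eqv_act, E|]. now apply (num_supported (S i)).
      * change (val (pact g p) i n = Some (negb (X n))).
        now rewrite val_pact, (perm_inv_fix g i Ei), Fi, V.
  - exists nat, num. intros z p H. eapply densely_mono; [exact H|].
    intros q _ (n & E & _). now exists n.
Qed.

(** The symmetric difference of the [i]-th generic real with the ground-model set [X]. *)
Definition real i X : cohen_elt :=
  proj1_sig (constructive_indefinite_description _ (real_exists i X)).

Lemma mem_real i X z p : mem z (real i X) p <->
  densely (fun q => exists n, eqv z (num n) q /\ val q i n = Some (negb (X n))) p.
Proof. unfold real. now destruct (constructive_indefinite_description _ _). Qed.

Lemma act_num (g : flip_perm) k p : eqv (act g (num k)) (num k) p.
Proof. apply (num_supported 0). intros i Hi. lia. Qed.

Lemma mem_real_act g i X z p : mem z (real i X) p ->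
  mem (act g z) (real (perm g i) (fun n => xorb (flip g (perm g i) n) (X n))) (pact g p).
Proof.
  intros H. apply mem_real in H. apply mem_real. apply (densely_inv g) in H.
  eapply densely_mono; [exact H|]. intros q _ (n & E & V). exists n.
  apply (eqv_act g) in E. rewrite app_inv in E. split.
  - eapply eqv_trans; [exact E|apply act_num].
  - change (val (pact (flip_perm_inv g) q) i n = Some (negb (X n))) in V.
    rewrite val_pact in V. simpl in V.
    destruct (val q (perm g i) n) as [b|]; [|discriminate]. simpl in V. f_equal.
    injection V. now destruct b, (flip g (perm g i) n), (X n).
Qed.

(** The flipped bits of a row form a ground-model set, which is absorbed into [X]. *)
Lemma act_real g i X p :
  eqv (act g (real i X)) (real (perm g i) (fun n => xorb (flip g (perm g i) n) (X n))) p.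
Proof.
  apply eqv_act_incl; [exact (mem_real_act g i X)|]. intros z q H.
  apply (mem_real_act (flip_perm_inv g)) in H. simpl in H. rewrite perm_inv_perm in H.
  replace (fun n => _) with X in H; [exact H|]. apply functional_extensionality.
  intros n. now destruct (flip g (perm g i) n), (X n).
Qed.

Lemma atom_exists i : exists x : cohen_elt, forall z p, mem z x p <->
  densely (fun q => exists X, eqv z (real i X) q) p.
Proof.
  apply (comprehension (S i)).
  - apply class_exists with (Ψ := fun X z q => eqv z (real i X) q).
    + intros X z p q. apply eqv_le.
    + intros X z z' p E E'. eapply eqv_trans; [apply eqv_sym, E|exact E'].
    + intros X g Hg z p E. destruct (Hg i) as [Ei _]; [lia|]. eexists.
      eapply eqv_trans; [apply eqv_act, E|]. eapply eqv_trans; [apply act_real|].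
      rewrite Ei. apply eqv_refl.
  - exists (nat -> bool), (real i). auto.
Qed.

Definition atom i : cohen_elt := proj1_sig (constructive_indefinite_description _ (atom_exists i)).

Lemma mem_atom i z p : mem z (atom i) p <-> densely (fun q => exists X, eqv z (real i X) q) p.
Proof. unfold atom. now destruct (constructive_indefinite_description _ _). Qed.

Lemma mem_atom_act g i z p : mem z (atom i) p -> mem (act g z) (atom (perm g i)) (pact g p).
Proof.
  intros H. apply mem_atom in H. apply mem_atom. apply (densely_inv g) in H.
  eapply densely_mono; [exact H|]. intros q _ (X & E). eexists.
  apply (eqv_act g) in E. rewrite app_inv in E.
  eapply eqv_trans; [exact E|apply act_real].
Qed.

(** Flips merely permute the ground-model sets [X], so only the permutation of indices is visible on
    atoms. *)
Lemma act_atom g i p : eqv (act g (atom i)) (atom (perm g i)) p.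
Proof.
  apply eqv_act_incl; [exact (mem_atom_act g i)|]. intros z q H.
  apply (mem_atom_act (flip_perm_inv g)) in H. simpl in H. now rewrite perm_inv_perm in H.
Qed.

(* Otherwise [a_i = a_j Δ X] for a ground-model [X], which a large enough undecided bit refutes. *)
Lemma atom_inj i j p : eqv (atom i) (atom j) p -> i = j.
Proof.
  intros E. apply NNPP. intros Hij.
  assert (H : mem (real i (fun _ => false)) (atom i) p).
  { apply mem_atom, densely_intro. intros q _. eexists. apply eqv_refl. }
  apply (mem_eq_r _ _ _ _ E), mem_atom in H.
  destruct (H p (le_refl _ _)) as (q & Hq & X & E').
  destruct (undecided q) as [n Hn].
  pose (r := update (update q i n true) j n (X n)).
  assert (Hr : r ≤ q).
  { eapply le_trans; apply update_le; [|now apply Hn]. simpl.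
    destruct (Nat.eqb_spec i j); [easy|]. now apply Hn. }
  assert (M : mem (num n) (real i (fun _ => false)) r).
  { apply mem_real, densely_intro. intros s Hs. exists n. split; [apply eqv_refl|].
    apply Hs. simpl. rewrite Nat.eqb_refl. destruct (Nat.eqb_spec j i); [now subst|].
    simpl. now rewrite Nat.eqb_refl. }
  apply (mem_eq_r _ _ _ _ (eqv_le _ _ _ _ Hr E')), mem_real in M.
  destruct (M r (le_refl _ _)) as (s & Hs & n' & En & V).
  apply num_inj in En as <-.
  assert (V' : val s j n = Some (X n)) by (apply Hs, val_update).
  rewrite V' in V. now destruct (X n).
Qed.

Lemma atoms_exist : exists x : cohen_elt, forall z p, mem z x p <->
  densely (fun q => exists i, eqv z (atom i) q) p.
Proof.
  apply (comprehension 0).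
  - apply class_exists with (Ψ := fun i z q => eqv z (atom i) q).
    + intros i z p q. apply eqv_le.
    + intros i z z' p E E'. eapply eqv_trans; [apply eqv_sym, E|exact E'].
    + intros i g _ z p E. eexists. eapply eqv_trans; [apply eqv_act, E|apply act_atom].
  - exists nat, atom. auto.
Qed.

Definition atoms : cohen_elt := proj1_sig (constructive_indefinite_description _ atoms_exist).

Lemma mem_atoms z p : mem z atoms p <-> densely (fun q => exists i, eqv z (atom i) q) p.
Proof. unfold atoms. now destruct (constructive_indefinite_description _ _). Qed.

Lemma atom_mem_atoms i p : mem (atom i) atoms p.
Proof. apply mem_atoms, densely_intro. intros q _. exists i. apply eqv_refl. Qed.

Lemma atoms_supported n : supported n atoms.
Proof.
  intros g _ p. apply eqv_act_incl; intros z q H; apply mem_atoms in H; apply mem_atoms;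
    [apply (densely_inv g) in H|apply (densely_inv (flip_perm_inv g)) in H];
    (eapply densely_mono; [exact H|]); intros r _ (i & E).
  - exists (perm g i). apply (eqv_act g) in E. rewrite app_inv in E.
    eapply eqv_trans; [exact E|apply act_atom].
  - exists (perm_inv g i). apply (eqv_act (flip_perm_inv g)) in E. rewrite app_inv in E.
    eapply eqv_trans; [exact E|apply (act_atom (flip_perm_inv g))].
Qed.

(** * The cofinite filter on the atoms *)

Definition cofinite (n : nat) (z : cohen_elt) (p : pcond) : Prop :=
  subset z atoms p /\ forall k, n <= k -> mem (atom k) z p.

Lemma cofinite_filter_exists : exists u : cohen_elt, forall z p, mem z u p <->
  densely (fun q => exists n, cofinite n z q) p.
Proof.
  apply (comprehension 0).
  - apply class_exists with (Ψ := cofinite).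
    + intros n z p q Hq [H1 H2]. split; [eapply subset_le; eauto|].
      intros k Hk. eapply mem_le; [exact Hq|auto].
    + intros n z z' p E [H1 H2]. split.
      * intros a q Hq Ha. apply (H1 a q Hq). eapply mem_eq_r; [|exact Ha].
        apply eqv_sym. eapply eqv_le; eauto.
      * intros k Hk. eapply mem_eq_r; [exact E|auto].
    (* The bound need not be invariant: [g] fixes the atoms from [B] on, hence the new bound
       [n + B]. *)
    + intros n g Hg z p [H1 H2]. destruct (perm_finite g) as [B HB]. exists (n + B). split.
      * intros a q Hq Ha. apply (mem_act (inv cohen g)) in Ha. rewrite inv_act in Ha.
        apply H1 in Ha; [|now apply (le_app_inv (W := cohen))].
        apply (mem_act g) in Ha. rewrite act_inv, app_inv in Ha.
        eapply mem_eq_r; [|exact Ha]. now apply (atoms_supported 0).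
      * intros k Hk. assert (K : mem (atom k) z p) by (apply H2; lia).
        apply (mem_act g) in K. eapply mem_eq_l; [|exact K].
        rewrite <- (HB k) at 2 by lia. apply act_atom.
  - destruct (power_exists atoms) as [y Hy].
    eapply small_incl; [|exact (elements_small y)]. intros z p H. cbn.
    apply Hy, subset_dense. eapply densely_mono; [exact H|]. intros q _ [n [K _]]. exact K.
Qed.

(** The flips make [swap r i j] carry the [i]-th row of [r] to one compatible with the [j]-th row,
    and conversely. *)
Definition swap (r : pcond) (i j : nat) : flip_perm.
Proof.
  pose (t := fun k => if k =? i then j else if k =? j then i else k).
  refine {| perm := t; perm_inv := t;
    flip := fun k n => ((k =? i) || (k =? j)) &&
      match val r i n, val r j n with Some a, Some b => xorb a b | _, _ => false end |}.
  1, 2: intros k; unfold t; destruct (Nat.eqb_spec k i) as [->|];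
    [|destruct (Nat.eqb_spec k j) as [->|]];
    repeat match goal with |- context [?a =? ?b] => destruct (Nat.eqb_spec a b) end; congruence.
  exists (S i + S j). intros k Hk. unfold t.
  destruct (Nat.eqb_spec k i), (Nat.eqb_spec k j); lia.
Defined.

(** Where both rows are decided, the flip turns the value in one row into that of the other; where
    at most one is, no conflict arises. The union of the two conditions is then a common
    extension. *)
Lemma swap_compatible r i j : exists q, q ≤ r /\ q ≤ pact (swap r i j) r.
Proof.
  assert (C : forall k n a b, val r k n = Some a ->
    val (pact (swap r i j) r) k n = Some b -> a = b).
  { intros k n a b. rewrite val_pact. simpl.
    destruct (Nat.eqb_spec k i) as [Ei|], (Nat.eqb_spec k j) as [Ej|]; simpl;
      try rewrite <- Ei; try rewrite <- Ej; intros E; rewrite ?E.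
    - destruct a; simpl; congruence.
    - destruct (val r j n) as [c|]; simpl; [|congruence]. now destruct a, b, c.
    - destruct (val r i n) as [c|]; simpl; [|congruence]. now destruct a, b, c.
    - destruct a; simpl; congruence. }
  set (r' := pact (swap r i j) r) in *.
  assert (F : finite_support (fun k n =>
    match val r k n with Some b => Some b | None => val r' k n end)).
  { destruct (proj2_sig r) as [N HN], (proj2_sig r') as [N' HN']. exists (N + N').
    intros k n H. unfold val. rewrite HN, HN'; auto; lia. }
  exists (exist _ _ F). split; intros k n b E; simpl.
  - now rewrite E.
  - destruct (val r k n) as [a|] eqn:E'; auto. f_equal. eapply C; eauto.
Qed.

Lemma swap_fixes r i j m : m <= i -> m <= j -> pfixes m (swap r i j).
Proof.
  intros Hi Hj k Hk. simpl.
  destruct (Nat.eqb_spec k i); [lia|]. destruct (Nat.eqb_spec k j); [lia|]. auto.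
Qed.

(** At a common extension of [r] and its image under the swap, the transported statement puts
    [atom j] into [z], as the swap fixes [z]. *)
Lemma atoms_indiscernible m z i j p :
  supported m z -> m <= i -> m <= j -> mem (atom i) z p -> mem (atom j) z p.
Proof.
  intros Hz Hi Hj H. apply mem_dense, densely_NNPP. intros r Hr K.
  destruct (swap_compatible r i j) as (q & Hq & Hq'). apply (K q Hq).
  apply (mem_le _ _ _ _ Hr), (mem_act (swap r i j)), (mem_le _ _ _ _ Hq') in H.
  eapply mem_eq_r; [apply (Hz (swap r i j)); now apply swap_fixes|]. eapply mem_eq_l; [|exact H].
  pose proof (act_atom (swap r i j) i q) as E. simpl in E. now rewrite Nat.eqb_refl in E.
Qed.

Lemma valid_WUF : valid (W := cohen) WUF.
Proof.
  intros ρ p _. destruct cofinite_filter_exists as [u Hu].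
  apply forces_ex, densely_intro. intros p1 _. exists atoms.
  apply forces_ex, densely_intro. intros p2 _. exists u.
  apply forces_and. split.
  - apply forces_ultrafilter. cbn [econs]. repeat apply conj.
    + intros y q _ H. apply Hu in H. apply subset_dense.
      eapply densely_mono; [exact H|]. intros r _ [n [K _]]. exact K.
    + apply Hu, densely_intro. intros q _. exists 0. split; [intros z r _; auto|].
      intros k _. apply atom_mem_atoms.
    + intros y q _ H K. apply Hu in K. destruct (K q (le_refl _ _)) as (r & Hr & n & _ & L).
      exact (H (atom n) r Hr (L n (le_n _))).
    + intros y z q _ H K L. apply Hu in H. apply Hu.
      eapply densely_mono; [exact H|]. intros r Hr (n & _ & M). exists n. split.
      * eapply subset_le; eauto.
      * intros k Hk. apply K; auto.
    + intros y z c q _ H K L. apply Hu in H, K. apply Hu.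
      eapply densely_bind; [exact H|]. intros r Hr (n & Y1 & Y2).
      eapply densely_mono; [exact (densely_le _ _ _ Hr K)|].
      intros s Hs (n' & Z1 & Z2). exists (n + n'). split.
      * intros a t Ht Ha. apply L in Ha as [Ha _]; [|ord]. apply (Y1 a t); auto. ord.
      * intros k Hk. apply L; [ord|]. split; [|apply Z2; lia].
        eapply mem_le; [exact Hs|apply Y2; lia].
    (* With [m] a support of [y], indiscernibility leaves two cases: all atoms from [m] on are in
       [y], or none is, and then they are in [z]. *)
    + intros y z q _ H K. destruct (has_support y) as [m Hm]. apply densely_NNPP.
      intros r Hr N. apply (N r (le_refl _ _)). right.
      apply Hu, densely_intro. intros s Hs. exists m. split.
      * intros a t Ht Ha. apply K in Ha; [tauto|ord].
      * intros k Hk. apply K; [ord|]. split; [apply atom_mem_atoms|].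
        intros t Ht Ha. apply (N t); [ord|]. left. apply Hu, densely_intro.
        intros v Hv. exists m. split; [eapply subset_le; [|exact H]; ord|].
        intros j Hj. apply (atoms_indiscernible m y k j); auto. eapply mem_le; eauto.
  - intros q _ H. apply forces_ex in H.
    destruct (H q (le_refl _ _)) as (r & Hr & a & K). apply forces_and in K as [Ha K].
    cbn [forces econs] in Ha. apply mem_atoms in Ha.
    destruct (Ha r (le_refl _ _)) as (s & Hs & i & E).
    destruct (has_support (atom i)) as [m Hm].
    (* [b] is the singleton of the supposed generating point; principality would put it into [u]. *)
    destruct (forces_separation (fun _ => atom i) (Eq 0 1) atoms) as [b Hb]; [now exists m|].
    assert (Hbu : mem b u s).
    { pose proof (proj1 (forces_all _ _ _) K b) as Kb. rewrite forces_iff in Kb.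
      apply (Kb s Hs), forces_and. split.
      - intros z t _ Hz. now apply Hb in Hz.
      - apply Hb. split; [|exact E]. eapply mem_eq_l; [apply eqv_sym, E|]. apply atom_mem_atoms. }
    apply Hu in Hbu. destruct (Hbu s (le_refl _ _)) as (t & _ & n & _ & L).
    (* The index lies beyond the cofiniteness bound [n] and differs from [i]. *)
    assert (M : mem (atom (n + S i)) b t) by (apply L; lia).
    apply Hb in M as [_ M]. apply atom_inj in M. lia.
Qed.

Theorem theorem7p9 :
  consistent ZFC ->
  consistent (extend (extend ZF WUF) every_ultrafilter_sigma_complete).
Proof.
  intros _. apply (valid_consistent (W := cohen) _ weakest zero).
  intros φ [[H| ->]| ->].
  - now apply valid_ZF.
  - exact valid_WUF.
  - exact valid_sigma_complete.
Qed.
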